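(* Let $(i_k)_{k\in\mathbb{Z}_{>0}}$ be a sequence in $I$ satisfying the following condition: (1) if $C$ is of finite type, $(i_k)_{k\in\mathbb{Z}_{>0}}$ is commutation-equivalent to another sequence $(j_k)_{k\in\mathbb{Z}_{>0}}$ such that $(j_1,\ldots,j_l)$ is a reduced word, with $l$ being the length of the longest element $w_0\in W$, and $j_{k+l}=j_k^*$ for all $k\in\mathbb{Z}_{>0}$; (2) if $C$ is of infinite type, $(i_1,i_2,\ldots,i_k)$ is a reduced word for all $k\in\mathbb{Z}_{>0}$, and $|\{k\in\mathbb{Z}_{>0}\mid i_k=i\}|=\infty$ for each $i\in I$. Then, for any $i,j\in I$, we have $$\tilde C_{ij}(q,t,\underline{\mu})=q^{-d_j}t\sum_{k\in\mathbb{Z}_{>0};\,i_k=j}(\varpi_i^\vee,\,T_{i_1}\cdots T_{i_{k-1}}\alpha_j)_\Gamma .$$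
   Context: Let $I$ be a finite set and $C=(c_{ij})_{i,j\in I}$ an irreducible symmetrizable generalized Cartan matrix (GCM): $c_{ii}=2$; $c_{ij}\in\mathbb{Z}_{\le 0}$ for $i\ne j$; $c_{ij}=0$ iff $c_{ji}=0$; there is $D=\mathrm{diag}(d_i\mid i\in I)$ with $d_i\in\mathbb{Z}_{>0}$ such that $DC$ is symmetric (a symmetrizer; fixed); and, writing $i\sim j$ when $c_{ij}<0$, any two elements of $I$ are connected by a chain of $\sim$. $C$ is of finite type if it is positive definite, and of infinite type otherwise. For $i\sim j$ put $g_{ij}=\gcd(|c_{ij}|,|c_{ji}|)$ and $f_{ij}=|c_{ij}|/g_{ij}$. Let $\mathsf{Q}=\bigoplus_{i\in I}\mathbb{Z}\alpha_i$, $s_i\alpha_j=\alpha_j-c_{ij}\alpha_i$, and let $W\subset\mathrm{Aut}(\mathsf{Q})$ be the Weyl group generated by the $s_i$ (a Coxeter group); $(i_1,\dots,i_k)$ is a reduced word if $s_{i_1}\cdots s_{i_k}$ has length $k$. In finite type, $w_0$ is the longest element of $W$ and $i\mapsto i^*$ is the involution of $I$ with $w_0\alpha_i=-\alpha_{i^*}$. $\Gamma$ is the multiplicative abelian group generated by $q,t$ and $\mu_{ij}^{(g)}$ ($i\sim j$, $1\le g\le g_{ij}$) with relations $\mu_{ij}^{(g)}\mu_{ji}^{(g)}=1$ (free abelian of finite rank); $\Gamma_0$ is the subgroup generated by $q$ and all $\mu_{ij}^{(g)}$, so $\mathbb{Z}[\Gamma]=\mathbb{Z}[\Gamma_0][t^{\pm1}]$.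 With $[k]_q=(q^k-q^{-k})/(q-q^{-1})$, $C(q,t,\underline{\mu})$ is the matrix with $C_{ii}=q^{d_i}t^{-1}+q^{-d_i}t$, $C_{ij}=-[f_{ij}]_{q^{d_i}}\sum_{g=1}^{g_{ij}}\mu_{ij}^{(g)}$ if $c_{ij}<0$, and $C_{ij}=0$ otherwise. It is invertible over $\mathbb{Z}[\Gamma_0](\!(t)\!)$ with inverse $\tilde C(q,t,\underline{\mu})$. Let $\mathbb{Q}(\Gamma)$ be the fraction field of $\mathbb{Z}[\Gamma]$, and $\phi$ the automorphism with $\phi(q)=q,\phi(t)=t,\phi(\mu_{ij}^{(g)})=\mu_{ji}^{(g)}$; write $a^\phi=\phi(a)$. On $\mathsf{Q}_\Gamma=\bigoplus_i\mathbb{Q}(\Gamma)\alpha_i$ let $(-,-)_\Gamma$ be the non-degenerate form with $(\alpha_i,\alpha_j)_\Gamma=[d_i]_qC_{ij}(q,t,\underline{\mu})$ and $(ax,by)_\Gamma=a^\phi b(x,y)_\Gamma$; it satisfies $(x,y)_\Gamma=(y,x)_\Gamma^\phi$. Let $\alpha_i^\vee=q^{-d_i}t[d_i]_q^{-1}\alpha_i$, and let $\{\varpi_i^\vee\}$ be the dual basis of $\{\alpha_i\}$, i.e. $(\varpi_i^\vee,\alpha_j)_\Gamma=\delta_{i,j}$. Let $T_i$ be the $\mathbb{Q}(\Gamma)$-linear automorphism $T_ix=x-(\alpha_i^\vee,x)_\Gamma\alpha_i$, so $T_i\alpha_j=\alpha_j-q^{-d_i}tC_{ij}(q,t,\underline{\mu})\alpha_i$.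 Sequences $(i_k)_{k>0}$ and $(j_k)_{k>0}$ in $I$ are commutation-equivalent if there is a bijection $\sigma:\mathbb{Z}_{>0}\to\mathbb{Z}_{>0}$ with $i_{\sigma(k)}=j_k$ for all $k$ and $c_{j_k,j_l}=0$ whenever $k<l$ and $\sigma(k)>\sigma(l)$. The infinite sum is understood in the $t$-adic topology of $\mathbb{Z}[\Gamma_0](\!(t)\!)$. *)

(* Defs.v *)
From HB Require Import structures.
From mathcomp Require Import all_boot all_order all_algebra.
From mathcomp Require Import boolp classical_sets functions cardinality fsbigop.
From mathcomp.multinomials Require Import mpoly.
Set Implicit Arguments. Unset Strict Implicit. Unset Printing Implicit Defensive.
Import Order.TTheory GRing.Theory Num.Theory.
From mathcomp Require Import zify.
Local Open Scope ring_scope.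

Section Laurent.
Variable R : comNzRingType.

(* R((t)): coefficient functions on Z vanishing below some bound. *)
Record laurent := Laurent {
  lcoef :> int -> R;
  lcoef_bounded : exists N : int, forall m : int, m < N -> lcoef m = 0 }.

HB.instance Definition _ := gen_eqMixin laurent.
HB.instance Definition _ := gen_choiceMixin laurent.

Lemma laurentP (f g : laurent) : lcoef f =1 lcoef g -> f = g.
Proof.
case: f g => [f hf] [g hg] /= /funext fg; case: _ / fg in hg *.
by rewrite (Prop_irrelevance hf hg).
Qed.

Definition conv (f g : int -> R) (m : int) : R :=
  \sum_(i \in [set: int]) f i * g (m - i).

Lemma convE (f g : int -> R) (a b : int) :
    (forall m, m < a -> f m = 0) -> (forall m, m < b -> g m = 0) ->
  forall n : nat, conv f g (a + b + n%:Z) =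
    (\poly_(k < n.+1) f (a + k%:Z) * \poly_(k < n.+1) g (b + k%:Z))`_n.
Proof.
move=> fa gb n; rewrite /conv.
rewrite (fsbigE [seq a + k%:Z | k <- iota 0 n.+1]); first last.
- move=> i _ /mapP ni; have [|ai] := ltP i a; first by move/fa ->; rewrite mul0r.
  have [|bi] := ltP (a + b + n%:Z - i) b; first by move/gb ->; rewrite mulr0.
  exfalso; apply: ni; exists `|i - a|%N; last by lia.
  by rewrite mem_iota; lia.
- by [].
- by rewrite map_inj_uniq ?iota_uniq // => x y; lia.
rewrite big_map coefM -(big_mkord xpredT (fun j : nat => (\poly_(k < n.+1) f (a + k%:Z))`_j *
   (\poly_(k < n.+1) g (b + k%:Z))`_(n - j))) /index_iota subn0.
rewrite big_mkcond big_seq [RHS]big_seq; apply: eq_bigr => k; rewrite mem_iota /= add0n => kn.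
rewrite mem_set // !coef_poly kn.
rewrite (_ : (n - k < n.+1)%N); last by lia.
by congr (_ * g _); lia.
Qed.

Lemma conv_small (f g : int -> R) (a b : int) :
    (forall m, m < a -> f m = 0) -> (forall m, m < b -> g m = 0) ->
  forall m, m < a + b -> conv f g m = 0.
Proof.
move=> fa gb m mab; apply: fsbig1 => i _.
have [|ai] := ltP i a; first by move/fa ->; rewrite mul0r.
by rewrite [g _]gb ?mulr0 //; lia.
Qed.

Lemma coef_conv (f g : int -> R) (a b : int) :
    (forall m, m < a -> f m = 0) -> (forall m, m < b -> g m = 0) ->
  forall N n : nat, (n < N)%N -> conv f g (a + b + n%:Z) =
    (\poly_(k < N) f (a + k%:Z) * \poly_(k < N) g (b + k%:Z))`_n.
Proof.
move=> fa gb N n nN; rewrite convE // !coefM; apply: eq_bigr => k _.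
rewrite !coef_poly (leq_trans (ltn_ord k) nN) ltn_ord.
by rewrite ltnS leq_subr (leq_ltn_trans (leq_subr k n) nN).
Qed.

Lemma laurent0_subproof : exists N : int, forall m : int, m < N -> (0 : R) = 0.
Proof. by exists 0. Qed.
Definition laurent0 := @Laurent (fun=> 0) laurent0_subproof.

Lemma laurentC_subproof (a : R) (e : int) :
  exists N : int, forall m : int, m < N -> (if m == e then a else 0) = 0.
Proof. by exists e => m; case: eqVneq => // ->; rewrite ltxx. Qed.
Definition laurent_monom a e := Laurent (laurentC_subproof a e).

Lemma laurentN_subproof (f : laurent) :
  exists N : int, forall m : int, m < N -> - f m = 0.
Proof. by case: (lcoef_bounded f) => N fN; exists N => m /fN ->; rewrite oppr0. Qed.
Definition laurentN f := Laurent (laurentN_subproof f).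

Lemma laurentD_subproof (f g : laurent) :
  exists N : int, forall m : int, m < N -> f m + g m = 0.
Proof.
case: (lcoef_bounded f) (lcoef_bounded g) => [N fN] [M gM].
exists (Num.min N M) => m; rewrite lt_min => /andP[/fN -> /gM ->].
by rewrite addr0.
Qed.
Definition laurentD f g := Laurent (laurentD_subproof f g).

Lemma laurentM_subproof (f g : laurent) :
  exists N : int, forall m : int, m < N -> conv f g m = 0.
Proof.
case: (lcoef_bounded f) (lcoef_bounded g) => [N fN] [M gM].
by exists (N + M); apply: conv_small.
Qed.
Definition laurentM f g := Laurent (laurentM_subproof f g).

Lemma laurent_addA : associative laurentD.
Proof. by move=> f g h; apply: laurentP => m /=; rewrite addrA. Qed.
Lemma laurent_addC : commutative laurentD.
Proof. by move=> f g; apply: laurentP => m /=; rewrite addrC. Qed.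
Lemma laurent_add0 : left_id laurent0 laurentD.
Proof. by move=> f; apply: laurentP => m /=; rewrite add0r. Qed.
Lemma laurent_addN : left_inverse laurent0 laurentN laurentD.
Proof. by move=> f; apply: laurentP => m /=; rewrite addNr. Qed.

HB.instance Definition _ :=
  GRing.isZmodule.Build laurent laurent_addA laurent_addC laurent_add0 laurent_addN.

Lemma conv_ext (f g : int -> R) (a : int) :
    (forall m, m < a -> f m = 0) -> (forall m, m < a -> g m = 0) ->
    (forall n : nat, f (a + n%:Z) = g (a + n%:Z)) -> f =1 g.
Proof.
move=> fa ga fg m; have [ma|am] := ltP m a; first by rewrite fa ?ga.
by rewrite (_ : m = a + `|m - a|%N%:Z) ?fg //; lia.
Qed.

Lemma laurent_mulA : associative laurentM.
Proof.
move=> f g h; apply: laurentP => m /=.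
case: (lcoef_bounded f) (lcoef_bounded g) (lcoef_bounded h) => [a fa] [b gb] [c hc].
have fg := conv_small fa gb; have gh := conv_small gb hc.
apply: (@conv_ext _ _ (a + b + c)) m; first by rewrite -addrA; apply: conv_small.
  exact: conv_small.
move=> n; transitivity ((\poly_(k < n.+1) f (a + k%:Z) *
    (\poly_(k < n.+1) g (b + k%:Z) * \poly_(k < n.+1) h (c + k%:Z)))`_n).
  rewrite -[a + b + c]addrA (convE fa gh) !coefM; apply: eq_bigr => k _.
  rewrite [in LHS]mulrC [in RHS]mulrC; congr (_ * _).
  by rewrite coef_poly ltnS leq_subr (coef_conv gb hc (N := n.+1)) ?ltnS ?leq_subr.
rewrite mulrA (convE fg hc) coefM [RHS]coefM; apply: eq_bigr => k _; congr (_ * _).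
by rewrite coef_poly ltn_ord (coef_conv fa gb (N := n.+1)).
Qed.

Lemma laurent_mulC : commutative laurentM.
Proof.
move=> f g; apply: laurentP => m /=.
case: (lcoef_bounded f) (lcoef_bounded g) => [a fa] [b gb].
apply: (@conv_ext _ _ (a + b)) m; first exact: conv_small.
  by rewrite addrC; apply: conv_small.
by move=> n; rewrite (convE fa gb) [a + b]addrC (convE gb fa) mulrC.
Qed.

Lemma laurent_mul1 : left_id (laurent_monom 1 0) laurentM.
Proof.
move=> f; apply: laurentP => m /=; rewrite /conv.
rewrite (fsbigE [:: 0%:Z]) //=; last first.
  by move=> i _; rewrite inE => /negPf ->; rewrite mul0r.
by rewrite big_mkcond big_seq1 mem_set //= mul1r subr0.
Qed.

Lemma laurent_mulDl : left_distributive laurentM laurentD.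
Proof.
move=> f g h; apply: laurentP => m /=.
case: (lcoef_bounded f) (lcoef_bounded g) (lcoef_bounded h) => [a fa] [b gb] [c hc].
pose l := Num.min a b.
have fl k : k < l -> f k = 0 by rewrite lt_min => /andP[/fa].
have gl k : k < l -> g k = 0 by rewrite lt_min => /andP[_ /gb].
have fgl k : k < l -> f k + g k = 0 by move=> kl; rewrite fl ?gl ?addr0.
apply: (@conv_ext _ (fun m => conv f h m + conv g h m) (l + c)) m.
- exact: conv_small.
- by move=> k kl; rewrite (conv_small fl hc) ?(conv_small gl hc) ?addr0.
- move=> n; rewrite (convE fgl hc) (convE fl hc) (convE gl hc) -coefD -mulrDl.
congr ((_ * _ : {poly R})`_n); apply/polyP => k; rewrite coefD !coef_poly.
by case: ifP; rewrite ?addr0.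
Qed.

Lemma laurent_1neq0 : laurent_monom 1 0 != laurent0.
Proof.
apply/eqP => /(congr1 (fun f : laurent => f 0)) /= /eqP.
by rewrite oner_eq0.
Qed.

HB.instance Definition _ := GRing.Zmodule_isComNzRing.Build laurent
  laurent_mulA laurent_mulC laurent_mul1 laurent_mulDl laurent_1neq0.

Definition laurent_unit : {pred laurent} := fun f => `[< exists g, g * f = 1 >].

Definition laurent_inv (f : laurent) : laurent :=
  xget f [set g | g * f = 1].

Lemma laurent_mulVx : {in laurent_unit, left_inverse 1 laurent_inv *%R}.
Proof. by move=> f /asboolP ex; apply: (xgetPex f ex). Qed.
Lemma laurent_unitPl (f g : laurent) : g * f = 1 -> laurent_unit f.
Proof. by move=> gf; apply/asboolP; exists g. Qed.
Lemma laurent_inv_out : {in [predC laurent_unit], laurent_inv =1 id}.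
Proof.
move=> f /asboolPn nf; rewrite /laurent_inv.
by case: xgetP => // g _ gf; case: nf; exists g.
Qed.

HB.instance Definition _ := GRing.ComNzRing_hasMulInverse.Build laurent
  laurent_mulVx laurent_unitPl laurent_inv_out.

End Laurent.

Section FracMap.
Variables (R : idomainType) (K : fieldType) (f : {rmorphism R -> K}).
Notation tofrac := (@FracField.tofrac R).
Notation repr := generic_quotient.repr.

Lemma frac_repr (x : {fraction R}) : x = tofrac (\n_(repr x)) / tofrac (\d_(repr x)).
Proof.
have d0 : tofrac (\d_(repr x)) != 0 by rewrite tofrac_eq0 denom_ratioP.
apply: (canRL (mulfK d0)).
rewrite -{1}[x]generic_quotient.reprK; set r := repr x.
unlock FracField.tofrac; rewrite -[LHS]FracField.pi_mul.
apply/generic_quotient.eqmodP; rewrite /= FracField.equivfE /FracField.mulf.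
by rewrite !numden_Ratio ?mulr1 ?oner_eq0 ?denom_ratioP // mulrC.
Qed.

Hypothesis f_inj : injective f.

Definition fracmap (x : {fraction R}) : K := f (\n_(repr x)) / f (\d_(repr x)).

Lemma fracmapE (a b : R) : b != 0 -> fracmap (tofrac a / tofrac b) = f a / f b.
Proof.
move=> b0; rewrite /fracmap; set x : {fraction R} := tofrac a / _.
have fn0 z : z != 0 -> f z != 0.
  by move=> z0; rewrite -(rmorph0 f) (inj_eq f_inj).
have := frac_repr x; set r := repr x => xr.
have d0 : \d_r != 0 := denom_ratioP r.
apply/eqP; rewrite eqr_div ?fn0 // -!rmorphM; apply/eqP; congr (f _).
move/eqP: xr; rewrite /x eqr_div ?tofrac_eq0 // -!tofracM tofrac_eq => /eqP.
by move=> ab; rewrite -ab.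
Qed.

Lemma fracmap_zmod : zmod_morphism fracmap.
Proof.
have fn0 z : z != 0 -> f z != 0.
  by move=> z0; rewrite -(rmorph0 f) (inj_eq f_inj).
move=> x y; rewrite (frac_repr x) (frac_repr y); set r := repr x; set s := repr y.
have r0 : \d_r != 0 := denom_ratioP r; have s0 : \d_s != 0 := denom_ratioP s.
rewrite -mulNr addf_div ?tofrac_eq0 // -tofracN -!tofracM -tofracD.
by rewrite !fracmapE ?mulf_neq0 // -mulNr addf_div ?fn0 // !(rmorphM, rmorphD, rmorphN).
Qed.

Lemma fracmap_monoid : monoid_morphism fracmap.
Proof.
split.
  by rewrite -(divr1 1) -tofrac1 fracmapE ?oner_eq0 // rmorph1 divr1.
move=> x y; rewrite (frac_repr x) (frac_repr y); set r := repr x; set s := repr y.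
have r0 : \d_r != 0 := denom_ratioP r; have s0 : \d_s != 0 := denom_ratioP s.
by rewrite mulf_div -!tofracM !fracmapE ?mulf_neq0 // mulf_div !rmorphM.
Qed.

Lemma fracmap_tofrac a : fracmap (tofrac a) = f a.
Proof. by rewrite -[tofrac a]divr1 -tofrac1 fracmapE ?oner_eq0 // rmorph1 divr1. Qed.

End FracMap.

Section MmapInv.
Variables (N : nat) (I : pred 'I_N).
Notation F := {fraction {mpoly int[N]}}.
Notation tofrac := (@FracField.tofrac {mpoly int[N]}).

Definition invvar (k : 'I_N) : F := if I k then (tofrac 'X_k)^-1 else tofrac 'X_k.

Lemma mmap_invvar_inj : injective (mmap (intr : int -> F) invvar).
Proof.
apply: raddf_inj => p p0; apply/eqP; apply: contra_eqT p0 => pn0.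
pose M := msize p.
pose s (m : 'X_{1..N}) : 'X_{1..N} := [multinom (if I k then M - m k else m k)%N | k < N].
have mM m k : m \in msupp p -> (m k <= M)%N.
  move/msize_mdeg_lt => /ltnW; apply: leq_trans; rewrite mdegE.
  by rewrite (bigD1 k) //= leq_addr.
have s_inj : {in msupp p &, injective s}.
  move=> m1 m2 m1p m2p /mnmP e; apply/mnmP => k; have := e k; rewrite !mnmE.
  have := mM m1 k m1p; have := mM m2 k m2p; case: (I k) => //; lia.
have X0 k : tofrac 'X_k != 0 by rewrite tofrac_eq0 -msupp_eq0 msuppX.
pose D : F := \prod_(k < N | I k) tofrac 'X_k ^+ M.
have ED : mmap intr invvar p * D = tofrac (\sum_(m <- msupp p) p@_m *: 'X_[s m]).
  rewrite /mmap mulr_suml rmorph_sum; apply: eq_big_seq => m mp.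
  rewrite -mul_mpolyC rmorphM /= -mulrA; congr (_ * _).
    by rewrite -[X in X%:MP]intz !rmorph_int.
  rewrite /mmap1 /D [in LHS](big_mkcond I) -big_split mpolyXE_id rmorph_prod /=.
  apply: eq_bigr => k _; rewrite rmorphXn /= mnmE /invvar.
  case: (I k); last by rewrite mulr1.
  by rewrite exprVn mulrC -expfB_cond ?(negPf (X0 k)) ?mM.
apply/eqP => E0; move: ED; rewrite E0 mul0r => /esym/eqP.
rewrite tofrac_eq0 => /eqP/(congr1 (fun q => q@_(s (mlead p)))).
rewrite mcoeff0 raddf_sum /= (bigD1_seq (mlead p)) ?msupp_uniq ?mlead_supp //=.
rewrite mcoeffZ mcoeffX eqxx mulr1 big_seq_cond big1 ?addr0.
  by move/eqP; rewrite -/(mleadc p) mleadc_eq0 (negPf pn0).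
move=> m /andP[mp mn]; rewrite mcoeffZ mcoeffX (inj_in_eq s_inj) ?mlead_supp //.
by rewrite (negPf mn) mulr0.
Qed.
End MmapInv.

Section Cartan.
Variables (n : nat) (c : 'M[int]_n) (d : 'I_n -> nat).

Definition GCM : Prop :=
  [/\ forall i, c i i = 2,
      forall i j, i != j -> c i j <= 0
    & forall i j, c i j = 0 <-> c j i = 0].

Definition symmetrized : 'M[int]_n := diag_mx (\row_i (d i)%:Z) *m c.

Definition symmetrizer : Prop :=
  (forall i, (0 < d i)%N) /\ symmetrized^T = symmetrized.

Definition irreducible_GCM : Prop := forall i j, connect (fun i j => c i j < 0) i j.

(* C itself need not be symmetric: positive definiteness of C is that of the
   symmetric matrix DC (for C = [2, -1; -3, 2] of type G2 the quadratic form
   of C is not definite). *)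
Definition finite_type : Prop :=
  forall x : 'cV[rat]_n, x != 0 -> 0 < (x^T *m map_mx intr symmetrized *m x) 0 0.

(* Q = Z^n as column vectors; an element of W is the matrix of its action on
   columns, so that products of matrices are products in W. *)
Definition sroot (i : 'I_n) : 'cV[int]_n := delta_mx i 0.

Definition srefl (i : 'I_n) : 'M[int]_n := 1%:M - delta_mx i i *m c.

Lemma srefl_sroot i j : srefl i *m sroot j = sroot j - c i j *: sroot i.
Proof.
rewrite mulmxBl mul1mx -mulmxA; congr (_ - _); apply/matrixP => k l.
rewrite -colE !mxE (bigD1 i) //= big1 ?addr0 => [|m mi].
  by rewrite !mxE eqxx andbT [l]ord1 eqxx andbT mulrC.
by rewrite !mxE (negPf mi) andbF mul0r.
Qed.

Definition wprod (w : seq 'I_n) : 'M[int]_n := \big[mulmx/1%:M]_(i <- w) srefl i.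

Definition has_length (g : 'M[int]_n) (l : nat) : Prop :=
  (exists2 w, wprod w = g & size w = l) /\ (forall w, wprod w = g -> (l <= size w)%N).

Definition reduced_word (w : seq 'I_n) : Prop := has_length (wprod w) (size w).

Definition longest (w0 : 'M[int]_n) (l : nat) : Prop :=
  has_length w0 l /\ forall g k, has_length g k -> (k <= l)%N.

Definition initial_word (s : nat -> 'I_n) (k : nat) : seq 'I_n := [seq s m | m <- iota 0 k].

(* Sequences indexed by k > 0 are functions on nat shifted by one: s k is
   i_(k+1). *)
Definition commutation_equivalent (s s' : nat -> 'I_n) : Prop :=
  exists sigma : nat -> nat,
    [/\ bijective sigma, forall k, s (sigma k) = s' k
      & forall k l, (k < l)%N -> (sigma k > sigma l)%N -> c (s' k) (s' l) = 0].

Definition finite_type_condition (s : nat -> 'I_n) : Prop :=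
  exists (s' : nat -> 'I_n) (w0 : 'M[int]_n) (l : nat) (star : 'I_n -> 'I_n),
    [/\ commutation_equivalent s s',
        longest w0 l,
        forall i, w0 *m sroot i = - sroot (star i),
        reduced_word (initial_word s' l)
      & forall k, s' (k + l)%N = star (s' k)].

Definition infinite_type_condition (s : nat -> 'I_n) : Prop :=
  (forall k, reduced_word (initial_word s k)) /\
  (forall i, infinite_set [set k | s k = i]).

Definition gcdC (i j : 'I_n) : nat := gcdn `|c i j| `|c j i|.
Definition fC (i j : 'I_n) : nat := `|c i j| %/ gcdC i j.

(* Since mu_ji^(g) is the inverse of mu_ij^(g), Gamma is freely generated by
   q, t and the mu_ij^(g) with i < j.  Q(Gamma) is realized as the field of
   rational functions in these variables, Gamma and Z[Gamma] inside it.  The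
   superscript g runs over 0, ..., g_ij - 1; g_ij = 0 when c_ij = 0. *)
Definition nmu (p : 'I_n * 'I_n) : nat := if (p.1 < p.2)%N then gcdC p.1 p.2 else 0.

Definition muvar : finType := {p : 'I_n * 'I_n & 'I_(nmu p)}.

Definition nvar : nat := 2 + #|muvar|.

Definition QGamma : fieldType := {fraction {mpoly int[nvar]}}.

Definition var (k : 'I_nvar) : QGamma := FracField.tofrac ('X_k : {mpoly int[nvar]}).

Definition qv : QGamma := var (lshift #|muvar| ord0).
Definition tv : QGamma := var (lshift #|muvar| ord_max).

Definition muv (p : 'I_n * 'I_n) (g : nat) : QGamma :=
  if (insub g : option 'I_(nmu p)) is Some h
  then var (rshift 2 (enum_rank (Tagged (fun p => 'I_(nmu p)) h : muvar)))
  else 1.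

Definition mu (i j : 'I_n) (g : nat) : QGamma :=
  if (i < j)%N then muv (i, j) g else (muv (j, i) g)^-1.

Lemma mu_neq0 i j g : mu i j g != 0.
Proof.
have m0 p k : muv p k != 0.
  rewrite /muv; case: insubP => [h _ _|_]; last exact: oner_neq0.
  by rewrite /var tofrac_eq0 -msupp_eq0 msuppX.
by rewrite /mu; case: ifP => _ //; rewrite invr_eq0.
Qed.

Lemma mu_mulV i j g : i != j -> mu i j g * mu j i g = 1.
Proof.
have /= ijg := mu_neq0 i j g; have /= jig := mu_neq0 j i g.
move: ijg jig; rewrite /mu neq_ltn => + + /orP[] lt.
  by rewrite lt ltnNge ltnW //= => ijg _; rewrite mulfV.
by rewrite lt ltnNge ltnW //= => _ jig; rewrite mulVf.
Qed.

Definition Gamma0 (x : QGamma) : Prop :=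
  exists (a : int) (e : 'I_n -> 'I_n -> nat -> int),
    x = qv ^ a * \prod_i \prod_(j | c i j < 0) \prod_(g < gcdC i j) mu i j g ^ e i j g.

Definition in_ZGamma0 : {pred QGamma} := fun x =>
  `[< exists2 s : seq (int * QGamma), (forall p, p \in s -> Gamma0 p.2)
        & x = \sum_(p <- s) p.1%:~R * p.2 >].

Lemma Gamma0_1 : Gamma0 1.
Proof.
exists 0, (fun _ _ _ => 0); rewrite expr0z mul1r big1 // => i _.
by rewrite big1 // => j _; rewrite big1.
Qed.

Lemma Gamma0M x y : Gamma0 x -> Gamma0 y -> Gamma0 (x * y).
Proof.
have q0 : qv != 0 by rewrite /qv /var tofrac_eq0 -msupp_eq0 msuppX.
move=> [a [e ->]] [b [f ->]]; exists (a + b), (fun i j g => e i j g + f i j g).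
rewrite expfzDr // mulrACA; congr (_ * _).
rewrite -big_split; apply: eq_bigr => i _ /=.
rewrite -big_split; apply: eq_bigr => j _ /=.
by rewrite -big_split; apply: eq_bigr => g _ /=; rewrite expfzDr ?mu_neq0.
Qed.

Lemma in_ZGamma0_subring : subring_closed in_ZGamma0.
Proof.
split.
- apply/asboolP; exists [:: (1, 1)]; last by rewrite big_seq1 mulr1.
  by move=> p; rewrite inE => /eqP -> /=; apply: Gamma0_1.
- move=> x y /asboolP[s hs ->] /asboolP[r hr ->]; apply/asboolP.
  exists (s ++ [seq (- p.1, p.2) | p <- r]).
    by move=> p; rewrite mem_cat => /orP[/hs //|/mapP[p' /hr ? ->]].
  rewrite big_cat big_map /=; congr (_ + _); rewrite -sumrN.
  by apply: eq_bigr => p _; rewrite rmorphN mulNr.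
- move=> x y /asboolP[s hs ->] /asboolP[r hr ->]; apply/asboolP.
  exists [seq (p.1 * p'.1, p.2 * p'.2) | p <- s, p' <- r].
    by move=> p /allpairsP[[p1 p2] /= [/hs h1 /hr h2 ->]]; apply: Gamma0M.
  rewrite big_allpairs_dep mulr_suml; apply: eq_bigr => p _.
  rewrite mulr_sumr; apply: eq_bigr => p' _ /=.
  by rewrite rmorphM mulrACA.
Qed.

HB.instance Definition _ := GRing.isSubringClosed.Build QGamma in_ZGamma0 in_ZGamma0_subring.

Record ZGamma0 := MkZGamma0 { ZGamma0_val : QGamma; _ : ZGamma0_val \in in_ZGamma0 }.
HB.instance Definition _ := [isSub for ZGamma0_val].
HB.instance Definition _ := [Choice of ZGamma0 by <:].
HB.instance Definition _ := [SubChoice_isSubComNzRing of ZGamma0 by <:].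

(* x in Z[Gamma] = Z[Gamma_0][t, t^-1] has Laurent polynomial s in t; s is
   unique because t is transcendental over the fraction field of Z[Gamma_0]. *)
Definition is_expansion (x : QGamma) (s : laurent ZGamma0) : Prop :=
  finite_set [set m : int | s m != 0]
  /\ x = \sum_(m \in [set: int]) ZGamma0_val (s m) * tv ^ m.

Definition in_ZGamma (x : QGamma) : Prop := exists s, is_expansion x s.

(* The inclusion of Z[Gamma] in Z[Gamma_0]((t)); 0 outside Z[Gamma]. *)
Definition expand (x : QGamma) : laurent ZGamma0 := xget 0 (is_expansion x).

(* S is the sum in Z[Gamma_0]((t)) of the u k with P k: the partial sums agree
   with S modulo t^N from some point on, for each N. *)
Definition tadic_sum (P : pred nat) (u : nat -> QGamma) (S : laurent ZGamma0) : Prop :=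
  (forall k, P k -> in_ZGamma (u k)) /\
  forall N : int, exists K : nat, forall k, (K <= k)%N -> forall e, e < N ->
    (\sum_(l < k | P l) expand (u l)) e = S e.

Definition qnum (k : nat) (x : QGamma) : QGamma := (x ^+ k - x ^- k) / (x - x^-1).

Definition qtC : 'M[QGamma]_n := \matrix_(i, j)
  if i == j then qv ^+ d i * tv^-1 + qv ^- d i * tv
  else if c i j < 0 then - (qnum (fC i j) (qv ^+ d i) * \sum_(g < gcdC i j) mu i j g)
  else 0.

Definition qtC_inv : 'M[laurent ZGamma0]_n := invmx (map_mx expand qtC).

(* phi fixes q and t and inverts each mu variable. *)
Definition phi_img (k : 'I_nvar) : bool := if fintype.split k is inr _ then true else false.

Definition phi : QGamma -> QGamma :=
  @fracmap {mpoly int[nvar]} QGamma (mmap intr (invvar phi_img)).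

HB.instance Definition _ := GRing.isZmodMorphism.Build QGamma QGamma phi
  (fracmap_zmod (@mmap_invvar_inj nvar phi_img)).
HB.instance Definition _ := GRing.isMonoidMorphism.Build QGamma QGamma phi
  (fracmap_monoid (@mmap_invvar_inj nvar phi_img)).

Lemma phi_var k : phi (var k) = if phi_img k then (var k)^-1 else var k.
Proof.
rewrite /phi /var (fracmap_tofrac (@mmap_invvar_inj nvar phi_img)) /=.
by rewrite mmapX mmap1U.
Qed.

Lemma phi_q : phi qv = qv.
Proof. by rewrite phi_var /phi_img (unsplitK (inl _)). Qed.

Lemma phi_t : phi tv = tv.
Proof. by rewrite phi_var /phi_img (unsplitK (inl _)). Qed.

Lemma phi_mu i j g : i != j -> phi (mu i j g) = mu j i g.
Proof.
have pm p : phi (muv p g) = (muv p g)^-1.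
  rewrite /muv; case: insubP => [h _ _|_]; last by rewrite rmorph1 invr1.
  by rewrite phi_var /phi_img (unsplitK (inr _)).
rewrite /mu neq_ltn => /orP[] lt; rewrite lt ltnNge ltnW //=.
by rewrite fmorphV /= pm invrK.
Qed.

Definition alpha (i : 'I_n) : 'cV[QGamma]_n := delta_mx i 0.

Definition gram : 'M[QGamma]_n := \matrix_(i, j) (qnum (d i) qv * qtC i j).

Definition formG (x y : 'cV[QGamma]_n) : QGamma := ((map_mx phi x)^T *m gram *m y) 0 0.

Definition alphav (i : 'I_n) : 'cV[QGamma]_n := (qv ^- d i * tv / qnum (d i) qv) *: alpha i.

Definition dual_basis (varpi : 'I_n -> 'cV[QGamma]_n) : Prop :=
  forall i j, formG (varpi i) (alpha j) = (i == j)%:R.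

Definition qtT (i : 'I_n) (x : 'cV[QGamma]_n) : 'cV[QGamma]_n :=
  x - formG (alphav i) x *: alpha i.

End Cartan.

(* Main.v *)
Require Import Defs.
From HB Require Import structures.
From mathcomp Require Import all_boot all_order all_algebra.
From mathcomp Require Import boolp classical_sets functions cardinality fsbigop.
From mathcomp.multinomials Require Import mpoly.
Set Implicit Arguments. Unset Strict Implicit. Unset Printing Implicit Defensive.
Import Order.TTheory GRing.Theory Num.Theory.
From mathcomp Require Import zify.
Local Open Scope ring_scope.

(* Put B_ij = q^(-d_i) t C_ij, so that T_i is left multiplication by 1 - E_ii B,
   and let P_k be the product of the first k of these operators.  Telescoping
   gives G_k B = 1 - P_k, where the (i, j) entry of G_k is the sum of the
   coefficients of alpha_i in T_(i_1) ... T_(i_(m-1)) alpha_j over m <= k with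
   i_m = j.  Since B = 1 modulo t, T_i is modulo t the projection killing
   alpha_i; hence any product of T's in which every letter occurs is divisible
   by t, and P_k tends to 0 t-adically as soon as every letter occurs infinitely
   often.  Then G_k converges to B^(-1), which is the claimed formula.

   In infinite type this recurrence is assumed.  In finite type it follows from
   the fact that a reduced word w of maximal length contains every letter: if i
   does not occur in w, then w alpha_i has coefficient 1 at alpha_i, and a
   shortest word for w s_i, which sends alpha_i to - w alpha_i, can be shortened
   to a word for w by the exchange property. *)

(** * The t-adic filtration on Laurent series *)

Section LaurentOrder.
Variable R : comNzRingType.
Implicit Types (f g : laurent R) (N : int).

Definition ordge N : {pred laurent R} := fun f => `[< forall m, m < N -> f m = 0 >].

Lemma ordgeP N f : reflect (forall m, m < N -> f m = 0) (f \in ordge N).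
Proof. exact: asboolP. Qed.

Lemma ordge_zmod N : zmod_closed (ordge N).
Proof.
split; first by apply/ordgeP.
by move=> f g /ordgeP f0 /ordgeP g0; apply/ordgeP => m mN /=; rewrite f0 ?g0 ?subr0.
Qed.
HB.instance Definition _ N := GRing.isZmodClosed.Build (laurent R) (ordge N) (ordge_zmod N).

Lemma ordgeM M N f g : f \in ordge M -> g \in ordge N -> f * g \in ordge (M + N).
Proof. by move=> /ordgeP f0 /ordgeP g0; apply/ordgeP; apply: conv_small. Qed.

Lemma ordgeW M N f : N <= M -> f \in ordge M -> f \in ordge N.
Proof. by move=> NM /ordgeP f0; apply/ordgeP => m /lt_le_trans/(_ NM)/f0. Qed.

Lemma ordge_monom a (e : int) : laurent_monom a e \in ordge e.
Proof. by apply/ordgeP => m /=; case: eqVneq => // ->; rewrite ltxx. Qed.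

Lemma ordge_eq f g : (forall N, f - g \in ordge N) -> f = g.
Proof.
move=> fg; apply: laurentP => m; apply/eqP; rewrite -subr_eq0; apply/eqP.
by have /ordgeP/(_ m) := fg (m + 1); apply; lia.
Qed.

(** Completeness of R[[t]]. The filtration is non-archimedean, so small consecutive differences
    already make each coefficient eventually constant. *)
Lemma laurent_limit (f : nat -> laurent R) :
    (forall k, f k \in ordge 0) ->
    (forall N, exists K, forall k, (K <= k)%N -> f k.+1 - f k \in ordge N) ->
  exists2 S, S \in ordge 0 &
    forall N, exists K, forall k, (K <= k)%N -> f k - S \in ordge N.
Proof.
move=> f0 /choice[K fK].
have stable (e : int) (k : nat) : (K (e + 1)%R <= k)%N -> f k e = f (K (e + 1)) e.
  elim: k => [|k IH]; first by rewrite leqn0 => /eqP ->.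
  rewrite leq_eqVlt => /orP[/eqP -> //|]; rewrite ltnS => Kk; rewrite -(IH Kk).
  have /ordgeP/(_ e) := fK _ _ Kk.
  rewrite ltrDl ltr01 => /(_ isT)/eqP; rewrite /= subr_eq0.
  by move/eqP.
(* From index [K (m + 1)] on, the coefficients in degrees below [m + 1] no longer change, so the
   limit takes its coefficient in degree [m] there. *)
have Sb : exists N : int, forall m : int, m < N -> f (K (m + 1)) m = 0.
  by exists 0 => m m0; have /ordgeP -> := f0 (K (m + 1)).
exists (Laurent Sb).
  by apply/ordgeP => m m0 /=; have /ordgeP -> := f0 (K (m + 1)).
(* Negative degrees vanish on both sides; only the finitely many degrees from 0 to [N - 1] constrain
   [k]. *)
move=> N; exists (\max_(e < `|N|.+1) K (e%:Z + 1)%R) => k Kk; apply/ordgeP => e eN /=.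
have [e0|e0] := ltP e 0.
  by have /ordgeP -> // := f0 k; have /ordgeP -> // := f0 (K (e + 1)); rewrite subr0.
rewrite stable ?subrr //; apply: leq_trans Kk.
have eN' : (`|e| < `|N|.+1)%N by lia.
rewrite -[X in K (X + 1)](_ : (Ordinal eN')%:Z = e); last by rewrite /=; lia.
exact: (leq_bigmax (F := fun e : 'I_(`|N|.+1) => K (e%:Z + 1)%R)).
Qed.

Lemma laurent_monomM a b (e e' : int) :
  laurent_monom a e * laurent_monom b e' = laurent_monom (a * b : R) (e + e').
Proof.
apply: laurentP => m; rewrite [LHS]/= /conv (fsbigE [:: e]) //=; last first.
  by move=> k _; rewrite inE => /negPf ->; rewrite mul0r.
rewrite big_mkcond big_seq1 mem_set //= eqxx subr_eq addrC.
by case: eqVneq; rewrite ?mulr0.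
Qed.

End LaurentOrder.

(** * Reflections attached to a matrix, and the telescoping sum *)

Lemma delta_mul_coef (A : pzRingType) n m (M : 'M[A]_(n, m)) (i k : 'I_n) l :
  (delta_mx i i *m M) k l = (k == i)%:R * M i l.
Proof.
rewrite mxE (bigD1 i) //= big1 ?addr0 => [|p pi]; first by rewrite mxE eqxx andbT.
by rewrite mxE (negPf pi) andbF mul0r.
Qed.

Lemma mul_delta_mul_coef (A : pzRingType) n m p (M : 'M[A]_(m, n)) (i : 'I_n) (M' : 'M_(n, p)) k l :
  (M *m (delta_mx i i *m M')) k l = M k i * M' i l.
Proof.
rewrite mxE (bigD1 i) //= big1 ?addr0 => [|q qi]; first by rewrite delta_mul_coef eqxx mul1r.
by rewrite delta_mul_coef (negPf qi) mul0r mulr0.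
Qed.

Section GeneralizedReflections.
Variables (A : comNzRingType) (n : nat) (B : 'M[A]_n).

(** One definition for three settings: [c] gives the simple reflections of W, [qtB] the operators
    T_i, and [laurentB] their t-adic expansions. *)
Definition gen_refl (i : 'I_n) : 'M[A]_n := 1%:M - delta_mx i i *m B.

Definition gen_word (w : seq 'I_n) : 'M[A]_n := \big[mulmx/1%:M]_(i <- w) gen_refl i.

Lemma gen_word_cons i w : gen_word (i :: w) = gen_refl i *m gen_word w.
Proof. by rewrite /gen_word big_cons. Qed.

Lemma gen_word_cat w w' : gen_word (w ++ w') = gen_word w *m gen_word w'.
Proof.
elim: w => [|i w IH]; first by rewrite [gen_word [::]]big_nil mul1mx.
by rewrite /= !gen_word_cons IH mulmxA.
Qed.

Lemma gen_word1 i : gen_word [:: i] = gen_refl i.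
Proof. by rewrite gen_word_cons [gen_word [::]]big_nil mulmx1. Qed.

Lemma gen_refl_mul m (M : 'M[A]_(n, m)) i k l :
  (gen_refl i *m M) k l = M k l - (k == i)%:R * (B *m M) i l.
Proof. by rewrite mulmxBl mul1mx -mulmxA mxE [X in _ + X]mxE delta_mul_coef. Qed.

Lemma initial_wordS (s : nat -> 'I_n) k : initial_word s k.+1 = rcons (initial_word s k) (s k).
Proof. by rewrite /initial_word -addn1 iotaD map_cat cats1. Qed.

Lemma initial_wordD (s : nat -> 'I_n) k l :
  initial_word s (k + l) = initial_word s k ++ initial_word (fun m => s (k + m)%N) l.
Proof.
rewrite /initial_word iotaD map_cat; congr (_ ++ _).
by rewrite add0n -[in LHS](addn0 k) iotaDl -map_comp.
Qed.

Variable s : nat -> 'I_n.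
Notation P k := (gen_word (initial_word s k)).

Definition refl_sum k : 'M[A]_n := \sum_(l < k) P l *m delta_mx (s l) (s l).

Lemma refl_sumE k i j : refl_sum k i j = \sum_(l < k | s l == j) P l i j.
Proof.
rewrite /refl_sum summxE [RHS]big_mkcond; apply: eq_bigr => l _.
rewrite mxE (bigD1 (s l)) //= big1 ?addr0 => [|m mi]; last by rewrite mxE (negPf mi) mulr0.
rewrite mxE eqxx eq_sym /=; by case: eqVneq => [->|]; rewrite ?mulr1 ?mulr0.
Qed.

(** The summand of index [l], times [B], is [P l - P l.+1], because [P l.+1] is [P l] followed by
    one more factor [1 - delta_mx (s l) (s l) *m B]. *)
Lemma refl_sum_telescope k : refl_sum k *m B = 1%:M - P k.
Proof.
elim: k => [|k IH]; first by rewrite /refl_sum /gen_word big_ord0 big_nil mul0mx subrr.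
rewrite /refl_sum big_ord_recr mulmxDl -/(refl_sum k) IH.
rewrite initial_wordS -cats1 gen_word_cat gen_word1 /gen_refl.
by rewrite mulmxBr mulmx1 mulmxA opprB addrCA addrC -addrA.
Qed.

End GeneralizedReflections.

(** * Convergence when every letter recurs *)

Section Convergence.
Variables (R : comNzRingType) (n : nat) (B : 'M[laurent R]_n).
Hypothesis B1 : forall i j, B i j - (i == j)%:R \in ordge 1.
Implicit Types (M : 'M[laurent R]_n) (w : seq 'I_n).

Lemma ordge0_1 : (1 : laurent R) \in ordge 0.
Proof. exact: (ordge_monom 1 0). Qed.

Lemma ordge0_bool (b : bool) : (b%:R : laurent R) \in ordge 0.
Proof. by case: b; rewrite ?rpred0 ?ordge0_1. Qed.

Lemma ordge_mulmx N N' M M' : (forall i j, M i j \in ordge N) ->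
  (forall i j, M' i j \in ordge N') -> forall i j, (M *m M') i j \in ordge (N + N').
Proof. by move=> MN MN' i j; rewrite mxE rpred_sum // => k _; rewrite ordgeM. Qed.

(** Modulo t each factor is the diagonal projection killing one basis vector; these multiply to the
    projection killing all letters of [w]. *)
Lemma gen_word_mod w i j : gen_word B w i j - ((i == j) && (j \notin w))%:R \in ordge 1.
Proof.
elim: w i j => [|k w IH] i j.
  by rewrite /gen_word big_nil mxE andbT subrr rpred0.
rewrite gen_word_cons; set M := gen_word B w in IH *.
rewrite gen_refl_mul in_cons negb_or.
have BM : (B *m M) k j - ((k == j) && (j \notin w))%:R \in ordge 1.
  rewrite mxE.
  (* [B] is split as [(B - 1) + 1]: the first part contributes only multiples of t, since the
     entries of [M] have order at least 0. *)
  rewrite [X in X - _](_ : _ = \sum_m ((B k m - (k == m)%:R) * M m j) + M k j); last first.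
    under [in RHS]eq_bigr do rewrite mulrBl.
    rewrite sumrB -addrA; apply/eqP; rewrite -subr_eq0 opprD addrA subrr add0r.
    rewrite opprD opprK subr_eq0; apply/eqP.
    rewrite (bigD1 k) //= eqxx mul1r big1 ?addr0 // => m /negPf mk.
    by rewrite eq_sym mk mul0r.
  rewrite -addrA rpredD // rpred_sum // => m _; apply: (@ordgeM _ 1 0) => //.
  rewrite -[M m j](subrK ((m == j) && (j \notin w))%:R) rpredD ?ordge0_bool //.
  by apply: ordgeW (IH m j).
suff -> : M i j - (i == k)%:R * (B *m M) k j - [&& i == j, j != k & j \notin w]%:R
    = (M i j - ((i == j) && (j \notin w))%:R)
      - (i == k)%:R * ((B *m M) k j - ((k == j) && (j \notin w))%:R).
  by rewrite rpredB //; apply: (@ordgeM _ 0 1); rewrite ?ordge0_bool.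
rewrite eq_sym [j == k]eq_sym; case: (eqVneq k i) => [->|ki]; rewrite ?mul1r ?mul0r.
  by case: (eqVneq i j) => /=; rewrite !subr0 // => _; rewrite opprB addrA subrK.
by rewrite !subr0; case: (eqVneq i j) => // <-; rewrite ki.
Qed.

Variable s : nat -> 'I_n.
Hypothesis s_inf : forall i, infinite_set [set k | s k = i].

Lemma letters_recur K : exists L, forall i, i \in initial_word (fun m => s (K + m)%N) L.
Proof.
have /choice[f fP] : forall i, exists k, (K <= k)%N /\ s k = i.
  move=> i; apply: contrapT => no; apply: (@s_inf i).
  apply: (sub_finite_set _ (finite_II K)) => k /= ski.
  by rewrite ltnNge; apply/negP => Kk; apply: no; exists k.
exists (\max_i f i).+1 => i; have [Kf sf] := fP i.
apply/mapP; exists (f i - K)%N; last by rewrite subnKC.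
by rewrite mem_iota /= add0n ltnS (leq_trans (leq_subr _ _)) // leq_bigmax.
Qed.

Lemma gen_word_ordge0 w i j : gen_word B w i j \in ordge 0.
Proof.
rewrite -[gen_word B w i j](subrK ((i == j) && (j \notin w))%:R).
by rewrite rpredD ?ordge0_bool //; apply: ordgeW (gen_word_mod w i j).
Qed.

(** Each window containing every letter contributes a factor t, and the letters after it cannot
    lower the order. *)
Lemma gen_word_cvg0 N : exists K, forall k, (K <= k)%N ->
  forall i j, gen_word B (initial_word s k) i j \in ordge N.
Proof.
suff [K PK] : exists K, forall i j, gen_word B (initial_word s K) i j \in ordge `|N|%N%:Z.
  exists K => k /subnKC <- i j; rewrite initial_wordD gen_word_cat.
  apply: (@ordgeW _ (`|N|%N%:Z + 0)); first by lia.
  by apply: ordge_mulmx => // {}i {}j; apply: gen_word_ordge0.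
elim: `|N|%N => [|m [K IH]]; first by exists 0 => i j; apply: gen_word_ordge0.
have [L LP] := letters_recur K; exists (K + L)%N => i j.
rewrite initial_wordD gen_word_cat -addn1 PoszD.
apply: ordge_mulmx => // {}i {}j; have := gen_word_mod (initial_word (fun m => s (K + m)%N) L) i j.
by rewrite LP andbF subr0.
Qed.

Lemma refl_sum_limit : exists2 S : 'M[laurent R]_n, S *m B = 1%:M
  & forall i j N, exists K, forall k, (K <= k)%N -> refl_sum B s k i j - S i j \in ordge N.
Proof.
have lim i j : exists2 S, S \in ordge 0 & forall N, exists K, forall k, (K <= k)%N ->
    refl_sum B s k i j - S \in ordge N.
  apply: laurent_limit => [k|N].
    by rewrite refl_sumE rpred_sum // => l _; apply: gen_word_ordge0.
  have [K KP] := gen_word_cvg0 N; exists K => k Kk.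
  rewrite !refl_sumE big_mkcond big_ord_recr -big_mkcond /= addrAC subrr add0r.
  by case: ifP => _; rewrite ?rpred0 ?KP.
pose S := \matrix_(i, j) sval (cid2 (lim i j)).
have SP i j N : exists K, forall k, (K <= k)%N -> refl_sum B s k i j - S i j \in ordge N.
  by rewrite mxE; case: cid2 => ? /=.
exists S => //; apply/matrixP => i j; apply: ordge_eq => N.
have [K KP] := gen_word_cvg0 N; have /choice[L LP] := fun m => SP i m N.
(* With G_k for [refl_sum B s k], [1 - S B] equals [(G_k - S) B + P_k]; this [k] is large enough for
   both terms to have order at least [N]. *)
pose k := maxn K (\max_m L m).
rewrite -[X in X \in _]opprK rpredN opprB.
rewrite -[X in X - _](subrK (gen_word B (initial_word s k) i j)).
have -> : (1%:M : 'M_n) i j - gen_word B (initial_word s k) i j = (refl_sum B s k *m B) i j.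
  by rewrite refl_sum_telescope [RHS]mxE [X in _ = _ + X]mxE.
rewrite addrAC rpredD ?KP ?leq_maxl // !mxE -sumrB rpred_sum // => m _.
rewrite -mulrBl -[N]addr0 ordgeM //.
  by apply: LP; rewrite leq_max (leq_bigmax (F := L)) ?orbT.
rewrite -[B m j](subrK (m == j)%:R) rpredD ?ordge0_bool //; exact: ordgeW (B1 m j).
Qed.

End Convergence.

(** * The Weyl group: invariant form, signs of roots, exchange property *)

Section Coxeter.
Variables (n : nat) (c : 'M[int]_n) (d : 'I_n -> nat).
Hypotheses (cGCM : GCM c) (d_sym : symmetrizer c d).
Implicit Types (i j : 'I_n) (w : seq 'I_n) (x y b : 'cV[int]_n).

Lemma GCM_diag i : c i i = 2. Proof. by case: cGCM. Qed.
Lemma symmetrizer_gt0 i : (0 < d i)%N. Proof. by case: d_sym. Qed.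

Lemma symmetrizedE i j : symmetrized c d i j = (d i)%:Z * c i j.
Proof. by rewrite /symmetrized mul_diag_mx !mxE. Qed.

Lemma symmetrized_sym i j : symmetrized c d i j = symmetrized c d j i.
Proof. by case: d_sym => _ /matrixP/(_ j i); rewrite mxE. Qed.

Definition sform x y : int := (x^T *m symmetrized c d *m y) 0 0.

Lemma sformE x y : sform x y = \sum_i \sum_j x i 0 * symmetrized c d i j * y j 0.
Proof.
rewrite /sform mxE exchange_big /=; apply: eq_bigr => j _.
by rewrite mxE mulr_suml; apply: eq_bigr => i _; rewrite mxE.
Qed.

Lemma sformC x y : sform x y = sform y x.
Proof.
rewrite !sformE exchange_big; apply: eq_bigr => i _; apply: eq_bigr => j _.
by rewrite symmetrized_sym mulrC mulrAC mulrA.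
Qed.

Lemma srefl_coef i m (M : 'M[int]_(n, m)) k l :
  (srefl c i *m M) k l = M k l - (k == i)%:R * (c *m M) i l.
Proof. exact: gen_refl_mul. Qed.

Lemma srefl_invol i : srefl c i *m srefl c i = 1%:M.
Proof.
apply/matrixP => k l; rewrite srefl_coef.
rewrite (_ : (c *m srefl c i) i l = - c i l); last first.
  rewrite mulmxBr mulmx1 mxE [X in _ + X]mxE mul_delta_mul_coef GCM_diag.
  by rewrite mulr2n mulrDl mul1r opprD addNKr.
by rewrite -[srefl c i]mulmx1 srefl_coef mulmx1 mulrN opprK subrK.
Qed.

(** A self-adjoint involution is an isometry. Self-adjointness comes from the symmetry of the
    rank-one matrix with entries d_i c_ik c_il. *)
Lemma srefl_isom i : (srefl c i)^T *m symmetrized c d *m srefl c i = symmetrized c d.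
Proof.
have E : symmetrized c d *m srefl c i = (srefl c i)^T *m symmetrized c d.
  rewrite /srefl [trmx _]linearB /= tr_scalar_mx mulmxBr mulmxBl mulmx1 mul1mx; congr (_ - _).
  have sT : (symmetrized c d)^T = symmetrized c d by case: d_sym.
  have E : (symmetrized c d *m (delta_mx i i *m c)) =
           \matrix_(k, l) ((d i)%:Z * c i k * c i l).
    by apply/matrixP => k l; rewrite mul_delta_mul_coef symmetrized_sym symmetrizedE mxE.
  rewrite -[RHS]trmxK trmx_mul trmxK sT E.
  by apply/matrixP => k l; rewrite !mxE mulrAC.
by rewrite -E -mulmxA srefl_invol mulmx1.
Qed.

Lemma wprod_cat w w' : wprod c (w ++ w') = wprod c w *m wprod c w'.
Proof. exact: gen_word_cat. Qed.

Lemma wprod_cons i w : wprod c (i :: w) = srefl c i *m wprod c w.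
Proof. exact: gen_word_cons. Qed.

Lemma wprod1 i : wprod c [:: i] = srefl c i.
Proof. exact: gen_word1. Qed.

Lemma wprod_unit w : wprod c w \in unitmx.
Proof.
rewrite /wprod; elim: w => [|i w IH]; rewrite ?big_nil ?unitmx1 // big_cons unitmx_mul IH andbT.
by case: (mulmx1_unit (srefl_invol i)).
Qed.

Lemma wprod_isom w : (wprod c w)^T *m symmetrized c d *m wprod c w = symmetrized c d.
Proof.
elim: w => [|i w IH]; first by rewrite /wprod big_nil tr_scalar_mx mul1mx mulmx1.
move: (symmetrized c d) (srefl_isom i) IH => S sS IH.
by rewrite wprod_cons trmx_mul !mulmxA -(mulmxA _ _ S) -(mulmxA _ (_ *m S)) sS.
Qed.

Lemma sform_wprod w x y : sform (wprod c w *m x) (wprod c w *m y) = sform x y.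
Proof.
rewrite /sform trmx_mul; move: (symmetrized c d) (wprod_isom w) => S SE.
by rewrite !mulmxA -(mulmxA _ _ S) -(mulmxA _ (_ *m S)) SE.
Qed.

(** A simple reflection changes only the coordinate of its own letter. *)
Lemma wprod_coef_notin w i x : i \notin w -> (wprod c w *m x) i 0 = x i 0.
Proof.
elim: w => [|k w IH]; first by rewrite /wprod big_nil mul1mx.
rewrite inE negb_or => /andP[/negPf ik iw].
by rewrite wprod_cons -mulmxA srefl_coef ik mul0r subr0 IH.
Qed.

(* Real roots of the orbit of [alpha_i] have the norm of [alpha_i], and the
   divisibility says that their coroots are integral. *)
Definition root_like i b : Prop :=
  sform b b = (d i)%:Z *+ 2 /\ forall j, ((d i)%:Z %| (d j)%:Z * b j 0%R)%Z.

Lemma sform_sroot i x : sform (sroot i) x = (d i)%:Z * (c *m x) i 0.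
Proof.
rewrite sformE (bigD1 i) //= [X in _ + X]big1 ?addr0.
  rewrite [(c *m x) i 0]mxE mulr_sumr; apply: eq_bigr => j _.
  by rewrite symmetrizedE mxE !eqxx mul1r mulrA.
by move=> j ji; rewrite big1 // => k _; rewrite mxE (negPf ji) !mul0r.
Qed.

Lemma c_sroot i j : (c *m sroot i) j 0 = c j i.
Proof.
rewrite mxE (bigD1 i) //= big1 ?addr0 => [|m mi]; first by rewrite mxE !eqxx mulr1.
by rewrite mxE (negPf mi) mulr0.
Qed.

Lemma sformZ (z : int) x : sform (z *: x) (z *: x) = z * z * sform x x.
Proof.
rewrite !sformE mulr_sumr; apply: eq_bigr => i _; rewrite mulr_sumr; apply: eq_bigr => j _.
rewrite [(z *: x) i _]mxE [(z *: x) j _]mxE.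
by move: (x i 0) (x j 0) (symmetrized c d i j) => u v w; lia.
Qed.

Lemma root_like_wprod i w : root_like i (wprod c w *m sroot i).
Proof.
split.
  by rewrite sform_wprod sform_sroot c_sroot GCM_diag mulr_natr.
elim: w => [|k w IH] j.
  rewrite /wprod big_nil mul1mx mxE eqxx andbT; case: eqVneq => [->|_].
    by rewrite mulr1 dvdzz.
  by rewrite mulr0 dvdz0.
rewrite wprod_cons -mulmxA srefl_coef mulrBr rpredB ?IH //.
case: eqVneq => [->|_]; last by rewrite mul0r mulr0 dvdz0.
rewrite mul1r mxE mulr_sumr rpred_sum // => m _.
(* By symmetry of DC, d_k c_km b_m = c_mk (d_m b_m), which d_i divides by induction. *)
by rewrite mulrA -symmetrizedE symmetrized_sym symmetrizedE mulrAC dvdz_mulr // IH.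
Qed.

(** Off-diagonal terms pair up, leaving the even diagonal. *)
Lemma symmetric_sum_even (a : 'I_n -> 'I_n -> int) :
    (forall i j, a i j = a j i) -> (forall i, (2 %| a i i)%Z) ->
  (2 %| (\sum_i \sum_j a i j)%R)%Z.
Proof.
move=> aC a2.
pose U : int := \sum_(i < n) \sum_(j < n | (i < j)%N) a i j.
rewrite (_ : \sum_i \sum_j a i j = \sum_i a i i + U *+ 2).
  have dU : (2 %| (U *+ 2)%R)%Z by apply/dvdzP; exists U; lia.
  by apply: rpredD dU; apply: rpred_sum.
rewrite mulr2n [X in U + X](_ : _ = \sum_(i < n) \sum_(j < n | (j < i)%N) a i j).
  rewrite addrA -!big_split /=; apply: eq_bigr => i _.
  rewrite (bigD1 i) //= -addrA; congr (_ + _).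
  rewrite (bigID (fun j : 'I_n => (i < j)%N)) /=; congr (_ + _); apply: eq_bigl => j.
    by rewrite neq_ltn; case: ltngtP.
  by rewrite -leqNgt neq_ltn; case: ltngtP.
rewrite /U (exchange_big_dep xpredT) //=.
by apply: eq_bigr => i _; apply: eq_bigr => j _; rewrite aC.
Qed.

(** With d_j x_j = d_i y_j, the form is d_i times the sum of the y_j c_jk x_k. This array is
    symmetric, being x_j d_j c_jk x_k divided by d_i, and its diagonal terms 2 y_j x_j are even. *)
Lemma sform_dvd i x : (forall j, ((d i)%:Z %| (d j)%:Z * x j 0%R)%Z) ->
  ((d i)%:Z *+ 2 %| sform x x)%Z.
Proof.
move=> dx; pose y j := ((d j)%:Z * x j 0%R %/ d i)%Z.
have yE j : (d j)%:Z * x j 0 = y j * d i by rewrite /y divzK.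
have di : (d i)%:Z != 0 by have := symmetrizer_gt0 i; lia.
have -> : sform x x = (d i)%:Z * \sum_j \sum_k y j * c j k * x k 0.
  rewrite sformE mulr_sumr; apply: eq_bigr => j _; rewrite mulr_sumr; apply: eq_bigr => k _.
  by rewrite symmetrizedE mulrA [x j 0 * _]mulrC yE [y j * _]mulrC !mulrA.
rewrite -mulr_natr dvdz_mul2l //; apply: symmetric_sum_even => [j k|j].
  apply: (mulfI di); rewrite !mulrA ![_%:Z * y _]mulrC -!yE.
  rewrite ![_ * x _ 0 * c _ _]mulrAC -!symmetrizedE symmetrized_sym.
  by rewrite mulrAC.
by rewrite GCM_diag mulrAC dvdz_mull.
Qed.

Hypothesis c_fin : finite_type c d.

Lemma sform_gt0 x : x != 0 -> 0 < sform x x.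
Proof.
move=> x0; have xr0 : map_mx intr x != 0 :> 'cV[rat]_n.
  apply: contraNneq x0 => /matrixP e; apply/eqP/matrixP => a b.
  by have /eqP := e a b; rewrite !mxE intr_eq0 => /eqP.
by have := c_fin xr0; rewrite map_trmx -!map_mxM mxE ltr0z.
Qed.

(* Writing a root as [p - m] with [p, m >= 0] of disjoint supports,
   [(p, m) <= 0], while [(p, p)] and [(m, m)] are multiples of the norm of the root. *)
Lemma root_like_sign i b : root_like i b ->
  (forall j, 0 <= b j 0) \/ (forall j, b j 0 <= 0).
Proof.
case=> bb db.
pose p : 'cV[int]_n := \col_j Num.max (b j 0) 0.
pose m : 'cV[int]_n := \col_j Num.max (- b j 0) 0.
have bE : b = p - m by apply/colP => j; rewrite !mxE; lia.
(* A nonzero vector built from coefficients of [b] up to sign inherits the divisibility, so its norm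
   is a positive multiple of 2 d_i. *)
have big x : (forall j, x j 0 = 0 \/ x j 0 = b j 0 \/ x j 0 = - b j 0) -> x != 0 ->
    (d i)%:Z *+ 2 <= sform x x.
  move=> xb x0; have s0 := sform_gt0 x0.
  have : ((d i)%:Z *+ 2 %| sform x x)%Z.
    apply: sform_dvd => j; have [->|[->|->]] := xb j; rewrite ?mulr0 ?dvdz0 //.
    by rewrite mulrN rpredN.
  case/dvdzP => k E; have dp : 0 < (d i)%:Z *+ 2 by have := symmetrizer_gt0 i; lia.
  by move: s0; rewrite E pmulr_lgt0 // => k0; apply: ler_peMl; lia.
have pm : sform p m <= 0.
  rewrite sformE; apply: sumr_le0 => j _; apply: sumr_le0 => k _.
  rewrite symmetrizedE !mxE; have := symmetrizer_gt0 j.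
  have [<- _|jk] := eqVneq j k.
    have [z0|z0] : Num.max (b j 0) 0 = 0 \/ Num.max (- b j 0) 0 = 0 by lia.
      by rewrite z0 !mul0r.
    by rewrite z0 mulr0.
  have cjk : c j k <= 0 by case: cGCM => _ + _; apply.
  move=> dj; apply: mulr_le0_ge0; last by lia.
  apply: mulr_ge0_le0; first by lia.
  by apply: mulr_ge0_le0.
have expd : sform b b = sform p p + sform m m - sform p m *+ 2.
  have BE x y z : sform (x - y) z = sform x z - sform y z.
    by rewrite /sform linearB /= !mulmxBl mxE [X in _ + X]mxE.
  by rewrite bE BE !(sformC _ (p - m)) !BE (sformC m p); lia.
have [p0|pn0] := eqVneq p 0.
  by right=> j; move/colP/(_ j): p0; rewrite !mxE; lia.
have [m0|mn0] := eqVneq m 0.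
  by left=> j; move/colP/(_ j): m0; rewrite !mxE; lia.
(* If both parts were nonzero, (b, b) would be at least 4 d_i, whereas it equals 2 d_i. *)
have bm : (d i)%:Z *+ 2 <= sform m m by apply: big mn0 => j; rewrite mxE; lia.
have bp : (d i)%:Z *+ 2 <= sform p p by apply: big pn0 => j; rewrite mxE; lia.
have := symmetrizer_gt0 i.
by lia.
Qed.

(** An isometry conjugates a reflection to the reflection in the image root, here alpha_k; comparing
    norms gives d_i = d_k, so the coroots match as well. *)
Lemma simple_conj i (k : 'I_n) w : wprod c w *m sroot i = sroot k ->
  srefl c k *m wprod c w = wprod c w *m srefl c i.
Proof.
move=> E; have [Eb _] := root_like_wprod i w.
have dik : d i = d k.
  by move: Eb; rewrite E sform_sroot c_sroot GCM_diag; lia.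
rewrite /srefl mulmxBl mulmxBr mul1mx mulmx1; congr (_ - _).
apply/matrixP => a e; rewrite mul_delta_mul_coef -mulmxA delta_mul_coef.
have -> : wprod c w a i = (a == k)%:R.
  by move/matrixP/(_ a 0): E; rewrite /sroot -colE !mxE andbT.
congr (_ * _); have dk0 : (d k)%:Z != 0 by have := symmetrizer_gt0 k; lia.
apply: (mulfI dk0); rewrite -{2}dik -symmetrizedE.
have : (sroot k)^T *m symmetrized c d *m wprod c w = (sroot i)^T *m symmetrized c d.
  rewrite -E trmx_mul; move: (symmetrized c d) (wprod_isom w) => S SE.
  by rewrite -[in RHS]SE !mulmxA.
rewrite /sroot !trmx_delta -mulmxA -!rowE => /matrixP/(_ 0 e).
rewrite [row k _ _ _]mxE [row i _ _ _]mxE => <-; rewrite [(c *m _) k e]mxE [RHS]mxE mulr_sumr.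
by apply: eq_bigr => m _; rewrite symmetrizedE mulrA.
Qed.

(** Induction on the word. If the tail already makes the root negative, a letter is removed there.
    Otherwise the first letter [k] causes the change of sign, which forces the tail to send alpha_i
    to alpha_k, and conjugation cancels [k]. *)
Lemma exchange i w : (exists j, (wprod c w *m sroot i) j 0 < 0) ->
  exists2 w', wprod c w' = wprod c w *m srefl c i & (size w' < size w)%N.
Proof.
elim: w => [|k w IH] [j].
  by rewrite /wprod big_nil mul1mx mxE; case: (_ && _).
have [neg _|nneg] := pselect (exists j, (wprod c w *m sroot i) j 0 < 0).
  have [w' E sw] := IH neg; exists (k :: w') => //.
  by rewrite !wprod_cons E mulmxA.
have nn m : 0 <= (wprod c w *m sroot i) m 0.
  by rewrite leNgt; apply/negP => neg; apply: nneg; exists m.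
move=> jneg; have [le0|ge0] := root_like_sign (root_like_wprod i (k :: w)).
  by move: (le0 j); rewrite leNgt jneg.
set b := wprod c w *m sroot i in nn.
(* Outside [k] the coordinates of [b] survive the reflection, so they are both nonnegative and
   nonpositive. *)
have bk m : m != k -> b m 0 = 0.
  move=> mk; apply/eqP; rewrite eq_le nn andbT.
  by have := ge0 m; rewrite wprod_cons -mulmxA srefl_coef (negPf mk) mul0r subr0.
have bE : b = b k 0 *: sroot k.
  apply/colP => m; rewrite [RHS]mxE [sroot k m 0]mxE andbT.
  by case: eqVneq => [->|/bk ->]; rewrite ?mulr1 ?mulr0.
have [bb bd] := root_like_wprod i w; rewrite -/b in bb bd.
(* For the coefficient z, norms give d_k z^2 = d_i and divisibility gives d_k z = e d_i; hence z e =
   1, and z = 1 as z is nonnegative. *)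
have b1 : b k 0 = 1.
  have {}bb : (d k)%:Z * (b k 0 * b k 0) = d i.
    have : sform b b = b k 0 * b k 0 * sform (sroot k) (sroot k) by rewrite {1 2}bE sformZ.
    by rewrite bb sform_sroot c_sroot GCM_diag; lia.
  have [e ee] := dvdzP (bd k); have di : 0 < (d i)%:Z := symmetrizer_gt0 i.
  have dk : 0 < (d k)%:Z := symmetrizer_gt0 k; have := nn k.
  move: (b k 0) (d k)%:Z (d i)%:Z bb ee dk di => z D D' <- ee D0 D'0 z0.
  have Dz : D * z != 0 by apply: contraTneq D'0; rewrite mulrA => ->; rewrite mul0r.
  have : D * z * 1 = D * z * (z * e) by rewrite mulr1 [LHS]ee; lia.
  move/(mulfI Dz) => ze; have e0 : 0 < e by nia.
  by nia.
exists w => //; rewrite wprod_cons (@simple_conj i k); last by rewrite -/b bE b1 scale1r.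
by rewrite -mulmxA srefl_invol mulmx1.
Qed.

Lemma reduced_full_support w : reduced_word c w ->
  (forall g k, has_length c g k -> (k <= size w)%N) -> forall i, i \in w.
Proof.
move=> [_ wmin] wmax i; apply/negPn/negP => iw.
pose g := wprod c w *m srefl c i.
have ex : exists m, `[< exists2 u, wprod c u = g & size u = m >].
  by exists (size w).+1; apply/asboolP; exists (rcons w i);
    rewrite ?size_rcons // -cats1 wprod_cat wprod1.
case: (ex_minnP ex) => m /asboolP[u ug um] mmin.
(* Maximality of [size w] bounds the length [m] of [g]; a word for [g s_i] shorter than [m] then
   contradicts the reducedness of [w]. *)
have mw : (m <= size w)%N.
  apply: (wmax g); split; first by exists u.
  by move=> v vg; apply: mmin; apply/asboolP; exists v.
have [|u' u'E] := @exchange i u.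
  exists i; rewrite ug /g -mulmxA srefl_sroot GCM_diag.
  rewrite (_ : sroot i - _ = - sroot i); last first.
    by rewrite scaler_nat mulr2n opprD addrA subrr add0r.
  by rewrite mulmxN mxE wprod_coef_notin // mxE eqxx.
rewrite um ltnNge => /negP; apply; apply: leq_trans mw _; apply: wmin.
by rewrite u'E ug /g -mulmxA srefl_invol mulmx1.
Qed.

(** The first period of [s'] is a reduced word of maximal length, so it contains every letter; later
    periods are its images under iterates of the permutation [star]. The commutation bijection
    transports the infinitely many occurrences to [s]. *)
Lemma finite_type_recurrent (s : nat -> 'I_n) i :
  finite_type_condition c s -> infinite_set [set k | s k = i].
Proof.
case=> s' [w0 [l [star [[sigma [sb ss' _]] [[[u uw0 ul] _] lmax] w0s red s'p]]]].
have lE : size (initial_word s' l) = l by rewrite size_map size_iota.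
have star_inj : injective star.
  move=> j k jk; have : w0 *m sroot j = w0 *m sroot k by rewrite !w0s jk.
  rewrite -uw0 => /(congr1 (mulmx (invmx (wprod c u)))).
  rewrite !mulKmx ?wprod_unit // => /matrixP/(_ j 0); rewrite !mxE !eqxx andbT.
  by case: eqVneq.
have s'm m k : s' (k + m * l)%N = iter m star (s' k).
  elim: m => [|m IH]; first by rewrite mul0n addn0.
  by rewrite mulSn addnCA addnC s'p IH.
have recur M : exists2 k, (M <= k)%N & s' k = i.
  (* The preimage of [i] under [M] iterations of [star] occurs in the first period, so [i] itself
     occurs [M] periods later. *)
  have /injF_bij[h _ hK] : injective (iter M star).
    by elim: M => //= M IH x y /star_inj/IH.
  have : h i \in initial_word s' l.
    by apply: reduced_full_support red _ _; rewrite lE.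
  case/mapP => k; rewrite mem_iota add0n /= => kl hk.
  exists (k + M * l)%N; last by rewrite s'm -hk hK.
  by rewrite (leq_trans (leq_pmulr M (leq_ltn_trans (leq0n k) kl))) // leq_addl.
move=> fin.
have {fin} : finite_set [set k : nat | s' k = i].
  have -> : [set k : nat | s' k = i]%classic = (sigma @^-1` [set k : nat | s k = i])%classic.
    by apply/seteqP; split => k /=; rewrite ss'.
  by apply: finite_preimage => // x y _ _; apply: (bij_inj sb).
case/finite_seqP => r rE; have [k rk s'k] := recur (\max_(m <- r) m).+1.
have : [set` r]%classic k by rewrite -rE.
by move=> /= kr; have := @leq_bigmax_seq _ r xpredT id k kr isT; rewrite leqNgt rk.
Qed.

End Coxeter.

(** * Scaling one variable, and a Vandermonde argument *)

Section VariableScaling.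
Variables (N : nat) (a b : 'I_N).
Notation F := {fraction {mpoly int[N]}}.
Notation tofrac := (@FracField.tofrac {mpoly int[N]}).

Definition scalevar (k : 'I_N) : F := if k == b then tofrac 'X_a * tofrac 'X_b else tofrac 'X_k.

(** Monomials go to monomials with distinct exponents, so nothing cancels. Injectivity is what
    extends the substitution to the fraction field. *)
Lemma mmap_scalevar_inj : a != b -> injective (mmap (intr : int -> F) scalevar).
Proof.
move=> ab; apply: raddf_inj => p p0; apply/eqP; apply: contra_eqT p0 => pn0.
(* Replacing X_b by X_a X_b adds the exponent of X_b to that of X_a. *)
pose s (m : 'X_{1..N}) : 'X_{1..N} := (m + U_(a) *+ m b)%MM.
have s_inj : injective s.
  move=> m1 m2 /mnmP e; have eb : m1 b = m2 b.
    by have := e b; rewrite !mnmDE !mulmnE !mnm1E (negPf ab) !addn0.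
  by apply/mnmP => k; have := e k; rewrite !mnmDE !mulmnE eb => /addIn.
have E : mmap intr scalevar p = tofrac (\sum_(m <- msupp p) p@_m *: 'X_[s m]).
  rewrite /mmap rmorph_sum; apply: eq_big_seq => m mp.
  rewrite -mul_mpolyC rmorphM /=; congr (_ * _).
    by rewrite -[X in X%:MP]intz !rmorph_int.
  rewrite /mmap1 /s mpolyXD rmorphM /= -mpolyXn rmorphXn /= [in RHS]mpolyXE_id rmorph_prod /=.
  rewrite (bigD1 b) //= [in RHS](bigD1 b) //= /scalevar eqxx exprMn rmorphXn /=.
  rewrite mulrC mulrAC mulrCA mulrA -[in RHS]mulrA [in RHS]mulrC; congr (_ * _ * _).
  by apply: eq_bigr => k /negPf ->; rewrite rmorphXn.
apply/eqP => E0; move: E; rewrite E0 => /esym/eqP.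
rewrite tofrac_eq0 => /eqP/(congr1 (fun q => q@_(s (mlead p)))).
rewrite mcoeff0 raddf_sum /= (bigD1_seq (mlead p)) ?msupp_uniq ?mlead_supp //=.
rewrite mcoeffZ mcoeffX eqxx mulr1 big1 ?addr0.
  by move/eqP; rewrite -/(mleadc p) mleadc_eq0 (negPf pn0).
by move=> m mn; rewrite mcoeffZ mcoeffX (inj_eq s_inj) (negPf mn) mulr0.
Qed.
End VariableScaling.

(* The power sums [\sum_m v_m * ev_m ^+ r] determine the [v_m]: evaluate the
   Lagrange polynomial vanishing at all [ev_m] but one. *)
Lemma power_sums_eq0 (K : fieldType) (I : eqType) (l : seq I) (ev v : I -> K) :
    uniq l -> injective ev -> (forall r, \sum_(m <- l) v m * ev m ^+ r = 0) ->
  forall m, m \in l -> v m = 0.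
Proof.
move=> ul inj v0 m ml.
have pv (p : {poly K}) : \sum_(i <- l) v i * p.[ev i] = 0.
  under eq_bigr do rewrite horner_coef mulr_sumr.
  rewrite exchange_big big1 // => k _ /=.
  under eq_bigr do rewrite mulrCA.
  by rewrite -mulr_sumr v0 mulr0.
have := pv (\prod_(i <- rem m l) ('X - (ev i)%:P)).
rewrite (bigD1_seq m) //= [X in _ + X]big_seq_cond [X in _ + X]big1 ?addr0.
  move/eqP; rewrite mulf_eq0 => /orP[/eqP //|].
  rewrite -[_ == 0]/(root _ _).
  rewrite -(big_map ev xpredT (fun x => 'X - x%:P)) root_prod_XsubC (mem_map inj).
  by rewrite mem_rem_uniqF.
move=> i /andP[il im]; apply/eqP; rewrite mulf_eq0; apply/orP; right.
rewrite -[_ == 0]/(root _ _).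
rewrite -(big_map ev xpredT (fun x => 'X - x%:P)) root_prod_XsubC (mem_map inj).
by rewrite mem_rem_uniq // inE im.
Qed.

(** * Expansion of Z[Gamma] in powers of t *)

Section Expansions.
Variables (n : nat) (c : 'M[int]_n).
Notation Q := (QGamma c).
Notation q := (qv c).
Notation t := (tv c).
Notation Z0 := (ZGamma0 c).

Lemma var_neq0 (k : 'I_(nvar c)) : var k != 0.
Proof. by rewrite /var tofrac_eq0 -msupp_eq0 msuppX. Qed.

Lemma qv_neq0 : q != 0. Proof. exact: var_neq0. Qed.
Lemma tv_neq0 : t != 0. Proof. exact: var_neq0. Qed.

Lemma qv_expn_neq1 (k : nat) : (0 < k)%N -> q ^+ k != 1.
Proof.
move=> k0; rewrite /qv /var -rmorphXn -tofrac1 tofrac_eq /= mpolyXn -mpolyX0.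
apply/eqP => /(congr1 (mcoeff 0%MM)); rewrite !mcoeffX eqxx.
case: eqP => // /(congr1 (fun m : 'X_{1..nvar c} => m (lshift #|muvar c| ord0))).
by rewrite mulmnE mnm1E eqxx mnm0E mul1n => k1; rewrite k1 in k0.
Qed.

Lemma qv_expz_inj : injective (fun m : int => q ^ m).
Proof.
have aux (k l : int) : k < l -> q ^ k != q ^ l.
  move=> kl; have -> : l = k + `|l - k|%N by lia.
  rewrite expfzDr ?qv_neq0 // -[X in X != _]mulr1 (inj_eq (mulfI _)) ?expfz_neq0 ?qv_neq0 //.
  by rewrite eq_sym qv_expn_neq1 //; lia.
move=> k l e; case: (ltgtP k l) => // /aux; by rewrite e eqxx.
Qed.

Lemma qt_index_neq : lshift #|muvar c| (ord0 : 'I_2) != lshift #|muvar c| ord_max.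
Proof. by rewrite (inj_eq (@lshift_inj _ _)). Qed.

(** The substitution t -> q t fixing q and the mu variables; since q is not a root of unity, it
    separates the powers of t. *)
Definition tscale : Q -> Q :=
  @fracmap {mpoly int[nvar c]} Q
    (mmap intr (scalevar (lshift #|muvar c| ord0) (lshift #|muvar c| ord_max))).

HB.instance Definition _ := GRing.isZmodMorphism.Build Q Q tscale
  (fracmap_zmod (mmap_scalevar_inj qt_index_neq)).
HB.instance Definition _ := GRing.isMonoidMorphism.Build Q Q tscale
  (fracmap_monoid (mmap_scalevar_inj qt_index_neq)).

Lemma tscale_var k : tscale (var k) = if k == lshift #|muvar c| ord_max then q * t else var k.
Proof.
rewrite /tscale /var (fracmap_tofrac (mmap_scalevar_inj qt_index_neq)) /=.
by rewrite mmapX mmap1U.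
Qed.

Lemma tscale_t : tscale t = q * t.
Proof. by rewrite tscale_var eqxx. Qed.

Lemma tscale_q : tscale q = q.
Proof. by rewrite tscale_var (negPf qt_index_neq). Qed.

Lemma tscale_mu i j g : tscale (mu c i j g) = mu c i j g.
Proof.
have E p : tscale (muv c p g) = muv c p g.
  rewrite /muv; case: insubP => [h _ _|_]; last exact: rmorph1.
  by rewrite tscale_var eq_rlshift.
by rewrite /mu; case: ifP => _; rewrite ?fmorphV /= E.
Qed.

Lemma tscale_ZGamma0 x : x \in @in_ZGamma0 _ c -> tscale x = x.
Proof.
case/asboolP => s sG ->; rewrite rmorph_sum; apply: eq_big_seq => p /sG[a [e ->]].
rewrite !rmorphM rmorph_int /= fmorphXz /= tscale_q; congr (_ * (_ * _)).
rewrite rmorph_prod; apply: eq_bigr => i _; rewrite rmorph_prod; apply: eq_bigr => j _.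
by rewrite rmorph_prod; apply: eq_bigr => g _; rewrite fmorphXz /= tscale_mu.
Qed.

(* [a m * t ^ m] is an eigenvector of [tscale] (t -> q t) for the eigenvalue [q ^ m]. *)
Lemma tv_transcendental (l : seq int) (a : int -> Q) : uniq l ->
    (forall m, a m \in @in_ZGamma0 _ c) -> \sum_(m <- l) a m * t ^ m = 0 ->
  forall m, m \in l -> a m = 0.
Proof.
move=> ul aZ a0 m ml.
have : a m * t ^ m = 0.
  apply: (@power_sums_eq0 _ _ l (fun m => q ^ m) (fun m => a m * t ^ m)) => //.
    exact: qv_expz_inj.
  (* Applying [tscale] multiplies the term of index m by q^m, which produces the next power sum. *)
  elim=> [|r IH]; first by rewrite -[RHS]a0; apply: eq_bigr => i _; rewrite mulr1.
  have := congr1 tscale IH; rewrite rmorph0 rmorph_sum /= => IH'.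
  rewrite -[RHS]IH'; apply: eq_bigr => i _.
  rewrite !rmorphM rmorphXn /= tscale_ZGamma0 // !fmorphXz /= tscale_q tscale_t.
  by rewrite expfzMl exprS -!mulrA; congr (_ * _); rewrite mulrCA.
by move/eqP; rewrite mulf_eq0 (negPf (expfz_neq0 _ tv_neq0)) orbF => /eqP.
Qed.

Lemma ZGamma0_val_0 : ZGamma0_val (0 : Z0) = 0.
Proof. exact: (rmorph0 (val : Z0 -> Q)). Qed.

Lemma ZGamma0_val_N1 : ZGamma0_val (-1 : Z0) = -1.
Proof. exact: (rmorphN1 (val : Z0 -> Q)). Qed.

Lemma ZGamma0_val_M (x y : Z0) : ZGamma0_val (x * y) = ZGamma0_val x * ZGamma0_val y.
Proof. exact: (rmorphM (val : Z0 -> Q)). Qed.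

Lemma ZGamma0_val_sum I (l : seq I) (F : I -> Z0) :
  ZGamma0_val (\sum_(i <- l) F i) = \sum_(i <- l) ZGamma0_val (F i).
Proof. exact: (rmorph_sum (val : Z0 -> Q)). Qed.

Lemma is_expansion_uniq x f g : is_expansion x f -> is_expansion (c := c) x g -> f = g.
Proof.
case=> /finite_seqP[r rE] xf [/finite_seqP[r' r'E] xg].
pose l := undup (r ++ r').
have sumE (h : laurent Z0) : (forall m, m \notin l -> h m = 0) ->
    \sum_(m \in [set: int]) ZGamma0_val (h m) * t ^ m = \sum_(m <- l) ZGamma0_val (h m) * t ^ m.
  move=> h0; rewrite (fsbigE l) ?undup_uniq //; last first.
    by move=> m _ /h0 ->; rewrite ZGamma0_val_0 mul0r.
  by apply: eq_bigl => m; rewrite mem_set.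
have fl m : m \notin l -> f m = 0.
  rewrite mem_undup mem_cat negb_or => /andP[+ _]; apply: contraNeq => fm.
  by have : [set` r]%classic m by rewrite -rE.
have gl m : m \notin l -> g m = 0.
  rewrite mem_undup mem_cat negb_or => /andP[_]; apply: contraNeq => fm.
  by have : [set` r']%classic m by rewrite -r'E.
apply: laurentP => m; have [ml|ml] := boolP (m \in l); last by rewrite fl ?gl.
apply: val_inj; apply/eqP; rewrite -subr_eq0; apply/eqP.
apply: (@tv_transcendental l (fun m => ZGamma0_val (f m) - ZGamma0_val (g m))) ml.
- exact: undup_uniq.
- by move=> k; rewrite rpredB ?(valP (f k)) ?(valP (g k)).
- under eq_bigr do rewrite mulrBl.
  by rewrite sumrB -!sumE // -xf -xg subrr.
Qed.

(** Lists may repeat exponents, so sums and products of Laurent polynomials need no normal form. *)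
Definition list_val (l : seq (Z0 * int)) : Q := \sum_(p <- l) ZGamma0_val p.1 * t ^ p.2.
Definition list_laurent (l : seq (Z0 * int)) : laurent Z0 := \sum_(p <- l) laurent_monom p.1 p.2.

(** A common list of monomials makes compatibility with ring operations direct; [expandE] returns to
    [expand] through uniqueness of expansions. *)
Definition expands (x : Q) (f : laurent Z0) : Prop :=
  exists2 l, x = list_val l & f = list_laurent l.

Lemma lcoef_sum (R : comNzRingType) I (l : seq I) (P : pred I) (F : I -> laurent R) (m : int) :
  (\sum_(i <- l | P i) F i) m = \sum_(i <- l | P i) F i m.
Proof. exact: (big_morph (fun f : laurent R => f m)). Qed.

Lemma list_expansion l : is_expansion (list_val l) (list_laurent l).
Proof.
have supp (m : int) : m \notin map snd l -> list_laurent l m = 0.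
  move=> ml; rewrite /list_laurent lcoef_sum big_seq big1 // => p pl /=.
  by case: eqVneq => // mp; rewrite mp map_f in ml.
split.
  apply: (sub_finite_set _ (finite_seq (map snd l))) => m /=.
  by apply: contraNT => /supp ->.
rewrite (fsbigE (undup (map snd l))) ?undup_uniq //; last first.
  by move=> m _; rewrite mem_undup => /supp ->; rewrite ZGamma0_val_0 mul0r.
rewrite big_mkcond /=; under eq_bigr do rewrite mem_set // lcoef_sum ZGamma0_val_sum mulr_suml.
rewrite exchange_big; apply: eq_big_seq => p pl /=.
rewrite (bigD1_seq p.2) ?undup_uniq ?mem_undup ?map_f //= eqxx big1 ?addr0 // => m /negPf ->.
by rewrite ZGamma0_val_0 mul0r.
Qed.

Lemma expands_in x f : expands x f -> in_ZGamma x.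
Proof. by case=> l -> _; exists (list_laurent l); apply: list_expansion. Qed.

Lemma expandE x f : expands x f -> expand x = f.
Proof.
case=> l -> ->; have le := list_expansion l; apply: (is_expansion_uniq _ (le)).
exact: (@xgetPex _ _ (is_expansion (list_val l)) (ex_intro _ _ le)).
Qed.

Lemma expands0 : expands 0 0.
Proof. by exists [::]; rewrite ?/list_val ?/list_laurent big_nil. Qed.

Lemma expands_monom (z : Z0) (e : int) : expands (ZGamma0_val z * t ^ e) (laurent_monom z e).
Proof. by exists [:: (z, e)]; rewrite ?/list_val ?/list_laurent big_seq1. Qed.

Lemma expandsD x y f g : expands x f -> expands y g -> expands (x + y) (f + g).
Proof.
by case=> l -> -> [r -> ->]; exists (l ++ r); rewrite ?/list_val ?/list_laurent big_cat.
Qed.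

Lemma expandsM x y f g : expands x f -> expands y g -> expands (x * y) (f * g).
Proof.
case=> l -> -> [r -> ->]; exists [seq (p.1 * p'.1, p.2 + p'.2) | p <- l, p' <- r].
  rewrite /list_val big_allpairs_dep mulr_suml; apply: eq_bigr => p _.
  rewrite mulr_sumr; apply: eq_bigr => p' _; rewrite /fst /snd.
  by rewrite ZGamma0_val_M expfzDr ?tv_neq0 // mulrACA.
rewrite /list_laurent big_allpairs_dep mulr_suml; apply: eq_bigr => p _.
by rewrite mulr_sumr; apply: eq_bigr => p' _ /=; rewrite laurent_monomM.
Qed.

Lemma expands1 : expands 1 1.
Proof. by have := expands_monom 1 0; rewrite mulr1. Qed.

Lemma expands_sum I (l : seq I) (P : pred I) (F : I -> Q) (G : I -> laurent Z0) :
  (forall i, P i -> expands (F i) (G i)) ->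
  expands (\sum_(i <- l | P i) F i) (\sum_(i <- l | P i) G i).
Proof. by move=> FG; apply: big_ind2 => //; [apply: expands0|move=> *; apply: expandsD]. Qed.

Lemma expandsN x f : expands x f -> expands (- x) (- f).
Proof.
move=> xf; rewrite -mulN1r -[- f]mulN1r; apply: expandsM => //.
have -> : - 1 = laurent_monom (-1 : Z0) 0.
  by apply: laurentP => m /=; case: ifP; rewrite ?oppr0.
by have := expands_monom (-1) 0; rewrite ZGamma0_val_N1 mulr1.
Qed.

Lemma expands_gen_word (M : 'M[Q]_n) (M' : 'M[laurent Z0]_n) w i j :
    (forall i j, expands (M i j) (M' i j)) ->
  expands (gen_word M w i j) (gen_word M' w i j).
Proof.
move=> MM'; elim: w i j => [|k w IH] i j.
  rewrite /gen_word !big_nil !mxE; case: eqP => _; [exact: expands1|exact: expands0].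
rewrite !gen_word_cons !gen_refl_mul; apply: expandsD => //; apply: expandsN.
case: eqP => _; last by rewrite !mul0r; apply: expands0.
by rewrite !mul1r !mxE; apply: expands_sum => m _; apply: expandsM.
Qed.

End Expansions.

(** * The deformed Cartan matrix and the operators T_i *)

Section DeformedCartan.
Variables (n : nat) (c : 'M[int]_n) (d : 'I_n -> nat).
Hypothesis d_gt0 : forall i, (0 < d i)%N.
Notation Q := (QGamma c).
Notation q := (qv c).
Notation t := (tv c).
Notation Z0 := (ZGamma0 c).
Implicit Types (i j : 'I_n) (w : seq 'I_n).

Lemma Gamma0_in x : Gamma0 x -> x \in @in_ZGamma0 _ c.
Proof.
move=> xG; apply/asboolP; exists [:: (1, x)]; last by rewrite big_seq1 mul1r.
by move=> p; rewrite inE => /eqP ->.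
Qed.

Lemma qv_in (e : int) : q ^ e \in @in_ZGamma0 _ c.
Proof.
apply: Gamma0_in; exists e, (fun _ _ _ => 0); rewrite [X in _ * X]big1 ?mulr1 // => i _.
by rewrite big1 // => j _; rewrite big1.
Qed.

Lemma mu_in i j (g : 'I_(gcdC c i j)) : c i j < 0 -> mu c i j g \in @in_ZGamma0 _ c.
Proof.
move=> cij; apply: Gamma0_in.
exists 0, (fun i' j' (g' : nat) => ((i' == i) && (j' == j) && (g' == g))%:Z); rewrite expr0z mul1r.
rewrite (bigD1 i) //= [X in _ * X]big1 => [|i' /negPf ii]; last first.
  by rewrite big1 // => j' _; rewrite big1 // => g' _; rewrite ii.
rewrite mulr1 (bigD1 j) //= [X in _ * X]big1 => [|j' /andP[_ /negPf jj]]; last first.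
  by rewrite big1 // => g' _; rewrite jj andbF.
rewrite mulr1 (bigD1 g) //= [X in _ * X]big1 => [|g' /negPf gg].
  by rewrite !eqxx mulr1 expr1z.
by rewrite -val_eqE /= in gg; rewrite gg andbF.
Qed.

(** This recursion exhibits the quotient defining a quantum number as a Laurent polynomial. *)
Lemma qnumS (x : Q) k : x - x^-1 != 0 -> qnum k.+1 x = x * qnum k x + x ^- k.
Proof.
move=> dx; apply: (mulIf dx); rewrite /qnum divfK // mulrDl -mulrA divfK //.
by rewrite !mulrBr -exprS [x ^- k * x]mulrC addrA subrK exprSr invfM.
Qed.

Lemma qnum_in k (e : int) : q ^ e - (q ^ e)^-1 != 0 -> qnum k (q ^ e) \in @in_ZGamma0 _ c.
Proof.
move=> e0; elim: k => [|k IH]; first by rewrite /qnum expr0 invr1 subrr mul0r rpred0.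
rewrite qnumS //.
apply: rpredD; first by apply: rpredM => //; apply: qv_in.
by rewrite exprnP exprz_exp invr_expz qv_in.
Qed.

Lemma qv_sub_inv_neq0 k : (0 < k)%N -> q ^+ k - q ^- k != 0.
Proof.
move=> k0; rewrite subr_eq0; apply/eqP => E.
have := @qv_expn_neq1 n c (k + k); rewrite addn_gt0 k0 => /(_ isT)/eqP; apply.
by rewrite exprD {1}E mulVf // expf_neq0 ?qv_neq0.
Qed.

Lemma qnum_neq0 k : (0 < k)%N -> qnum k q != 0.
Proof.
move=> k0; rewrite mulf_neq0 ?qv_sub_inv_neq0 // invr_eq0.
by have := @qv_sub_inv_neq0 1 isT; rewrite expr1.
Qed.

Definition qpow (e : int) : Z0 := MkZGamma0 (qv_in e).

Lemma expands_qt i : expands (q ^- d i * t) (laurent_monom (qpow (- (d i)%:Z)) 1).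
Proof. by have := expands_monom (qpow (- (d i)%:Z)) 1; rewrite /= -invr_expz. Qed.

Definition qtB : 'M[Q]_n := \matrix_(i, j) (q ^- d i * t * qtC c d i j).

(** Times q^(-d_i) t, a diagonal entry becomes 1 + q^(-2 d_i) t^2, while an off-diagonal entry, free
    of t, becomes a multiple of t. *)
Lemma qtC_expands i j : exists2 f, expands (qtC c d i j) f
  & laurent_monom (qpow (- (d i)%:Z)) 1 * f - (i == j)%:R \in ordge 1.
Proof.
rewrite mxE; case: eqVneq => [_|ij].
  exists (laurent_monom (qpow (d i)) (-1) + laurent_monom (qpow (- (d i)%:Z)) 1).
    apply: expandsD; first exact: (expands_monom (qpow (d i)) (-1)).
    exact: expands_qt.
  rewrite mulrDr !laurent_monomM subrr.
  have -> : qpow (- (d i)%:Z) * qpow (d i) = 1.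
    by apply: val_inj; rewrite /= -expfzDr ?qv_neq0 // addNr expr0z.
  rewrite addrAC subrr add0r; apply: ordgeW (ordge_monom _ _); by [].
case: ifP => cij; last first.
  by exists 0; [exact: expands0|rewrite mulr0 subr0 rpred0].
have zP : - (qnum (fC c i j) (q ^+ d i) * \sum_(g < gcdC c i j) mu c i j g) \in @in_ZGamma0 _ c.
  rewrite rpredN rpredM ?rpred_sum // => [|g _]; last exact: mu_in.
  by apply: (@qnum_in _ (d i)); rewrite qv_sub_inv_neq0.
exists (laurent_monom (MkZGamma0 zP) 0).
  by have := expands_monom (MkZGamma0 zP) 0; rewrite expr0z mulr1.
by rewrite laurent_monomM addr0 subr0; apply: ordge_monom.
Qed.

Lemma expands_qtC i j : expands (qtC c d i j) (expand (qtC c d i j)).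
Proof. by have [f fP _] := qtC_expands i j; rewrite (expandE fP). Qed.

Definition laurentB : 'M[laurent Z0]_n :=
  \matrix_(i, j) (laurent_monom (qpow (- (d i)%:Z)) 1 * expand (qtC c d i j)).

Lemma laurentB_mod i j : laurentB i j - (i == j)%:R \in ordge 1.
Proof. by rewrite [laurentB i j]mxE; have [f /expandE -> ?] := qtC_expands i j. Qed.

Lemma expands_qtB i j : expands (qtB i j) (laurentB i j).
Proof.
rewrite [qtB i j]mxE [laurentB i j]mxE.
by apply: expandsM; [apply: expands_qt|apply: expands_qtC].
Qed.

(** The coefficient of alpha_i^vee is fixed by [phi], and its denominator [d_i]_q cancels the same
    factor in the Gram matrix. *)
Lemma formG_alphav i (x : 'cV[Q]_n) : formG d (alphav c d i) x = (qtB *m x) i 0.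
Proof.
rewrite /formG /alphav; set k := _ / _.
have phik : phi k = k.
  by rewrite /k /qnum !(rmorphM, fmorphV, rmorphB, rmorphXn) /= phi_q phi_t.
have phia : map_mx (@phi n c) (k *: alpha c i) = k *: alpha c i.
  by apply/matrixP => a b; rewrite !mxE rmorphM /= phik rmorph_nat.
rewrite phia linearZ /= -!scalemxAl mxE /alpha trmx_delta -mulmxA -rowE !mxE mulr_sumr.
apply: eq_bigr => j _; rewrite [gram _ _ _ _]mxE [qtB _ _]mxE mulrA; congr (_ * _).
rewrite mulrA; congr (_ * _).
by rewrite /k mulfVK ?qnum_neq0.
Qed.

Lemma qtT_word w x : foldr (qtT d) x w = gen_word qtB w *m x.
Proof.
elim: w => [|i w IH] /=; first by rewrite /gen_word big_nil mul1mx.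
rewrite gen_word_cons -mulmxA -IH; apply/colP => k.
rewrite gen_refl_mul /qtT formG_alphav !mxE andbT; congr (_ - _).
by rewrite mulrC.
Qed.

Lemma formG_dual varpi i x : dual_basis d varpi -> formG (c := c) d (varpi i) x = x i 0.
Proof.
move=> dual; rewrite /formG mxE (bigD1 i) //= big1 ?addr0 => [|j ji].
  have := dual i i; rewrite /formG /alpha -colE !mxE eqxx => ->; by rewrite mul1r.
have := dual i j; rewrite /formG /alpha -colE mxE eq_sym (negPf ji) => ->; by rewrite mul0r.
Qed.

End DeformedCartan.

Theorem theorem1p8 (n : nat) (c : 'M[int]_n) (d : 'I_n -> nat)
    (cGCM : GCM c) (c_irr : irreducible_GCM c) (d_sym : symmetrizer c d)
    (varpi : 'I_n -> 'cV[QGamma c]_n) (varpi_dual : dual_basis d varpi)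
    (s : nat -> 'I_n)
    (s_fin : finite_type c d -> finite_type_condition c s)
    (s_inf : ~ finite_type c d -> infinite_type_condition c s)
    (i j : 'I_n) :
  exists S : laurent (ZGamma0 c),
    tadic_sum (fun k => s k == j)
      (fun k => formG d (varpi i) (foldr (qtT d) (alpha c j) (initial_word s k))) S
    /\ qtC_inv c d i j = expand (qv c ^- d j * tv c) * S.
Proof.
have recur l : infinite_set [set k | s k = l].
  case: (pselect (finite_type c d)) => [fin|inf]; last by have [_] := s_inf inf.
  exact: (finite_type_recurrent cGCM d_sym fin (s_fin fin)).
have d0 : forall l, (0 < d l)%N by case: d_sym.
have [S SB Slim] := refl_sum_limit (laurentB_mod c d0) recur.
(* [s k] stands for i_(k+1), so [initial_word s k] is the prefix strictly before it. *)
have term k : expands (formG d (varpi i) (foldr (qtT d) (alpha c j) (initial_word s k)))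
                      (gen_word (laurentB c d) (initial_word s k) i j).
  rewrite formG_dual // qtT_word // /alpha -colE mxE.
  by apply: expands_gen_word; apply: expands_qtB.
exists (S i j); split; first split.
- by move=> k _; apply: expands_in (term k).
- move=> N; have [K KP] := Slim i j N; exists K => k Kk e eN.
  have /ordgeP/(_ e eN)/eqP := KP k Kk; rewrite subr_eq0 => /eqP <-.
  rewrite refl_sumE; congr (lcoef _ e).
  by apply: eq_bigr => l _; rewrite (expandE (term l)).
(* [laurentB] is [D] times the expanded C, so [S] being its left inverse makes [S *m D] the inverse
   of C; [D] scales column j by q^(-d_j) t. *)
- pose D : 'M[laurent (ZGamma0 c)]_n :=
    diag_mx (\row_l laurent_monom (qpow c (- (d l)%:Z)) 1).
  have BD : laurentB c d = D *m map_mx (@expand n c) (qtC c d).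
    by apply/matrixP => a b; rewrite mul_diag_mx !mxE.
  rewrite BD mulmxA in SB; have [_ Cu] := mulmx1_unit SB.
  have -> : qtC_inv c d = S *m D.
    by rewrite /qtC_inv -[LHS]mul1mx -SB mulmxK.
  by rewrite mul_mx_diag !mxE (expandE (expands_qt _ _ _)) mulrC.
Qed.
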